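(* Let $0<T_{min}\le T_{max}<\infty$. Then the following statements are equivalent: (a) There exist matrices $P_i\in\mathbb{S}^{n+m}_{\succ0}$, $K_{j,i}\in\mathbb{R}^{m\times(n+m)}$, $i,j=1,\ldots,N$, and a nonnegative matrix $\Pi=[\pi_{ij}]\in\mathbb{R}^{N\times N}$ verifying $\mathbf{1}_N^T\Pi=\mathbf{1}_N^T$ such that $$e^{\bar A_i^T\theta}\left(\sum_{j=1}^N\pi_{ji}\bar J_{j,i}^TP_j\bar J_{j,i}\right)e^{\bar A_i\theta}-P_i\prec0$$ holds for all $i=1,\ldots,N$ and all $\theta\in[T_{min},T_{max}]$. (b) There exist differentiable matrix-valued functions $S_i:[0,T_{max}]\to\mathbb{S}^{n+m}$, matrices $P_i\in\mathbb{S}^{n+m}_{\succ0}$, $K_{j,i}\in\mathbb{R}^{m\times(n+m)}$, $i,j=1,\ldots,N$, a nonnegative matrix $\Pi\in\mathbb{R}^{N\times N}$ verifying $\mathbf{1}_N^T\Pi=\mathbf{1}_N^T$ and a scalar $\varepsilon>0$ such that $$-\dot{S}_i(\tau)+\bar A_i^TS_i(\tau)+S_i(\tau)\bar A_i\preceq0,$$ $$-P_i+S_i(\theta)+\varepsilon I\preceq0,$$ $$\sum_{j=1}^N\pi_{ji}\bar J_{j,i}^TP_j\bar J_{j,i}-S_i(0)\preceq0$$ hold for all $i=1,\ldots,N$, all $\tau\in[0,T_{max}]$ and all $\theta\in[T_{min},T_{max}]$. (c) There exist differentiable matrix-valued functions $\tilde S_i:[0,T_{max}]\to\mathbb{S}^{n+m}$,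 matrices $\tilde P_i\in\mathbb{S}^{n+m}_{\succ0}$, $U_{j,i}\in\mathbb{R}^{m\times(n+m)}$, $i,j=1,\ldots,N$, a nonnegative matrix $\Pi\in\mathbb{R}^{N\times N}$ verifying $\mathbf{1}_N^T\Pi=\mathbf{1}_N^T$ and a scalar $\varepsilon>0$ such that $$\dot{\tilde S}_i(\tau)+\tilde S_i(\tau)\bar A_i^T+\bar A_i\tilde S_i(\tau)\preceq0,$$ $$\tilde P_i-\tilde S_i(\theta)+\varepsilon I\preceq0,$$ $$\begin{bmatrix}-\tilde S_i(0)&V_i^T\\ V_i&-\operatorname{diag}_{j=1}^N\{\tilde P_j\}\end{bmatrix}\preceq0$$ hold for all $i=1,\ldots,N$, all $\tau\in[0,T_{max}]$ and all $\theta\in[T_{min},T_{max}]$, where $V_i=\operatorname{col}_{j=1}^N\{\pi_{ji}^{1/2}[\bar J_{j,i}^0\tilde S_i(0)+\bar J_{j,i}^1U_{j,i}]\}$. Moreover, when the conditions of statement (c) hold, then the inequality in (a) holds (for all $i$ and all $\theta\in[T_{min},T_{max}]$, with the same $\Pi$) with $K_{j,i}=U_{j,i}\tilde S_i(0)^{-1}$, $i,j=1,\ldots,N$, and $P_i=\tilde P_i^{-1}$, $i=1,\ldots,N$. As a result, the system $$\begin{array}{rcl}\dot{x}(t)&=&A_{\sigma(t)}x(t)+B_{\sigma(t)}u(t),\ t\in\mathbb{R}_{\ge0}\backslash\{t_k\}_{k=0}^\infty\\ u(t)&=&K_{\sigma(t_k^+),\sigma(t_k)}^1x(t_k)+K_{\sigma(t_k^+),\sigma(t_k)}^2u(t_k),\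 t\in(t_k,t_{k+1}]\\ x(t_k^+)&=&J_{\sigma(t_k^+),\sigma(t_k)}x(t_k),\ k\in\mathbb{Z}_{\ge0}\end{array}$$ with controller gains $[K_{j,i}^1\ \ K_{j,i}^2]=K_{j,i}=U_{j,i}\tilde S_i(0)^{-1}$ and min-jumping rule $$\sigma(t_k^+)=\operatorname*{arg\,min}_{j\in\{1,\ldots,N\}}\left\{\chi(t_k)^T\bar J_{j,\sigma(t_k)}^TP_j\bar J_{j,\sigma(t_k)}\chi(t_k)\right\},\qquad P_j=\tilde P_j^{-1},\ \chi=\mathrm{col}(x,u),$$ is asymptotically stable for any sequence $\{t_k\}_{k=0}^\infty$ satisfying the range dwell-time condition $t_{k+1}-t_k\in[T_{min},T_{max}]$ for all $k$.
   Context: $\mathbb{S}^{q}$ is the set of real symmetric $q\times q$ matrices, $\mathbb{S}^{q}_{\succ0}$ the positive definite ones; $X\preceq0$ (resp. $X\prec0$) means negative semidefinite (resp. definite). $\mathbf{1}_N$ is the $N$-vector of ones. A nonnegative matrix is a matrix with nonnegative entries. $\operatorname{diag}_{j=1}^N\{X_j\}$ is the block-diagonal matrix with blocks $X_1,\ldots,X_N$ and $\operatorname{col}_{j=1}^N\{X_j\}$ is the block column obtained by stacking $X_1,\ldots,X_N$. A dot on $S_i$ or $\tilde S_i$ denotes the derivative with respect to $\tau$. Data: integers $n,m,N\ge1$ and real matrices $A_i\in\mathbb{R}^{n\times n}$, $B_i\in\mathbb{R}^{n\times m}$, $J_{j,i}\in\mathbb{R}^{n\times n}$, $i,j=1,\ldots,N$.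 For gains $K_{j,i}=[K_{j,i}^1\ \ K_{j,i}^2]$ with $K_{j,i}^1\in\mathbb{R}^{m\times n}$, $K_{j,i}^2\in\mathbb{R}^{m\times m}$, set $$\bar A_i=\begin{bmatrix}A_i&B_i\\ 0&0\end{bmatrix},\quad \bar J_{j,i}=\begin{bmatrix}J_{j,i}&0\\ K_{j,i}^1&K_{j,i}^2\end{bmatrix}=\bar J_{j,i}^0+\bar J_{j,i}^1K_{j,i},\quad \bar J_{j,i}^0=\begin{bmatrix}J_{j,i}&0\\ 0&0\end{bmatrix},\quad \bar J_{j,i}^1=\begin{bmatrix}0\\ I_m\end{bmatrix}.$$ Trajectories are left-continuous: $x(t_k)=\lim_{s\uparrow t_k}x(s)$ and $x(t_k^+):=\lim_{s\downarrow t_k}x(s)$ (similarly for $u$, $\sigma$). The signal $\sigma:\mathbb{R}_{\ge0}\to\{1,\ldots,N\}$ is piecewise constant and only changes value at the instants $t_k$. With $\chi=\mathrm{col}(x,u)$ the system reads $\dot\chi=\bar A_{\sigma}\chi$ for $t\notin\{t_k\}$, $\chi(t_k^+)=\bar J_{\sigma(t_k^+),\sigma(t_k)}\chi(t_k)$. In the rule, if the minimizer is not unique, any minimizer may be chosen. Asymptotic stability is understood in the usual sense for the zero solution of this (augmented) system: Lyapunov stability and convergence of $\chi(t)$ to $0$ as $t\to\infty$. *)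

(* Defs.v *)
From HB Require Import structures.
From mathcomp Require Import all_boot all_order all_algebra.
From mathcomp Require Import all_classical all_reals all_analysis.
Set Implicit Arguments.
Unset Strict Implicit.
Unset Printing Implicit Defensive.
Import Order.TTheory GRing.Theory Num.Theory.
Import numFieldNormedType.Exports.
Local Open Scope classical_set_scope.
Local Open Scope ring_scope.

(* All three definiteness predicates include symmetry of the matrix. *)
Definition posdefmx (R : realType) (q : nat) (X : 'M[R]_q) : Prop :=
  X^T = X /\ forall v : 'cV[R]_q, v != 0 -> 0 < (v^T *m X *m v) 0 0.

Definition negdefmx (R : realType) (q : nat) (X : 'M[R]_q) : Prop :=
  X^T = X /\ forall v : 'cV[R]_q, v != 0 -> (v^T *m X *m v) 0 0 < 0.

Definition negsemidefmx (R : realType) (q : nat) (X : 'M[R]_q) : Prop :=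
  X^T = X /\ forall v : 'cV[R]_q, (v^T *m X *m v) 0 0 <= 0.

Definition expmx (R : realType) (q : nat) (X : 'M[R]_q) : 'M[R]_q :=
  limn (series (fun k => (k`!%:R)^-1 *: X ^+ k)).

(* Derivative of a function defined on a subset D of the real line: the
   difference quotient only involves points of D, so that at an endpoint of an
   interval the derivative is one-sided, and values outside D are irrelevant. *)
Section DeriveOn.
Variables (R : realType) (V : normedModType R).

Definition diff_quot (f : R -> V) (t s : R) : V := (s - t)^-1 *: (f s - f t).

Definition derivable_on (D : set R) (f : R -> V) (t : R) : Prop :=
  cvg (diff_quot f t @ within D t^').

Definition derive_on (D : set R) (f : R -> V) (t : R) : V :=
  lim (diff_quot f t @ within D t^').

End DeriveOn.

(* Global asymptotic stability of the zero solution, for a (possibly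
   nondeterministic) system given by its set of trajectories on [0, +oo[. *)
Definition asymptotically_stable (R : realType) (V : normedModType R)
    (sols : set (R -> V)) : Prop :=
  (forall e : R, 0 < e -> exists2 d : R, 0 < d &
     forall chi, sols chi -> `|chi 0| < d -> forall s, 0 <= s -> `|chi s| < e)
  /\ (forall chi, sols chi -> chi s @[s --> +oo] --> (0 : V)).

Section SwitchedSampledData.
Variables (R : realType) (n m N : nat).
Variables (A : 'I_N -> 'M[R]_n) (B : 'I_N -> 'M[R]_(n, m))
          (J : 'I_N -> 'I_N -> 'M[R]_n).

Definition Abar (i : 'I_N) : 'M[R]_(n + m) := block_mx (A i) (B i) 0 0.

Definition Jbar0 (j i : 'I_N) : 'M[R]_(n + m) := block_mx (J j i) 0 0 0.

Definition Jbar1 : 'M[R]_(n + m, m) := col_mx 0 1%:M.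

Definition gain1 (K : 'I_N -> 'I_N -> 'M[R]_(m, n + m)) (j i : 'I_N) :
  'M[R]_(m, n) := lsubmx (K j i).

Definition gain2 (K : 'I_N -> 'I_N -> 'M[R]_(m, n + m)) (j i : 'I_N) :
  'M[R]_m := rsubmx (K j i).

Definition Jbar (K : 'I_N -> 'I_N -> 'M[R]_(m, n + m)) (j i : 'I_N) :
  'M[R]_(n + m) := block_mx (J j i) 0 (gain1 K j i) (gain2 K j i).

Lemma JbarE K j i : Jbar K j i = Jbar0 j i + Jbar1 *m K j i.
Proof.
rewrite /Jbar /Jbar0 /Jbar1 /gain1 /gain2 -[K j i in RHS]hsubmxK.
rewrite mul_col_row !mul0mx !mul1mx add_block_mx.
by rewrite !addr0 !add0r.
Qed.

Definition col_stochastic (Pi : 'M[R]_N) : Prop :=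
  (forall i j, 0 <= Pi i j) /\
  (const_mx 1 : 'rV[R]_N) *m Pi = const_mx 1.

Definition jump_form (Pi : 'M[R]_N) (P : 'I_N -> 'M[R]_(n + m))
    (K : 'I_N -> 'I_N -> 'M[R]_(m, n + m)) (i : 'I_N) : 'M[R]_(n + m) :=
  \sum_(j < N) Pi j i *: ((Jbar K j i)^T *m P j *m Jbar K j i).

Variables Tmin Tmax : R.

Definition condition_a (P : 'I_N -> 'M[R]_(n + m))
    (K : 'I_N -> 'I_N -> 'M[R]_(m, n + m)) (Pi : 'M[R]_N) : Prop :=
  [/\ forall i, posdefmx (P i),
      col_stochastic Pi
    & forall (i : 'I_N) (theta : R), Tmin <= theta <= Tmax ->
        negdefmx (expmx (theta *: (Abar i)^T) *m jump_form Pi P K i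
                  *m expmx (theta *: Abar i) - P i)].

Definition differentiable_sym (S : 'I_N -> R -> 'M[R]_(n + m)) : Prop :=
  forall (i : 'I_N) (tau : R), 0 <= tau <= Tmax ->
    (S i tau)^T = S i tau /\ derivable_on `[0, Tmax] (S i) tau.

Definition condition_b (S : 'I_N -> R -> 'M[R]_(n + m))
    (P : 'I_N -> 'M[R]_(n + m)) (K : 'I_N -> 'I_N -> 'M[R]_(m, n + m))
    (Pi : 'M[R]_N) (eps : R) : Prop :=
  [/\ differentiable_sym S,
      forall i, posdefmx (P i),
      col_stochastic Pi,
      0 < eps
    & forall i : 'I_N,
      [/\ forall tau, 0 <= tau <= Tmax ->
            negsemidefmx (- derive_on `[0, Tmax] (S i) tau
                          + (Abar i)^T *m S i tau + S i tau *m Abar i),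
          forall theta, Tmin <= theta <= Tmax ->
            negsemidefmx (- P i + S i theta + eps%:M)
        & negsemidefmx (jump_form Pi P K i - S i 0)]].

Definition Vmx (Pi : 'M[R]_N) (S0 : 'M[R]_(n + m))
    (U : 'I_N -> 'I_N -> 'M[R]_(m, n + m)) (i : 'I_N) :
    'M[R]_(\sum_(j < N) (n + m), n + m) :=
  \mxcol_(j < N) (Num.sqrt (Pi j i) *: (Jbar0 j i *m S0 + Jbar1 *m U j i)).

Definition condition_c (S : 'I_N -> R -> 'M[R]_(n + m))
    (P : 'I_N -> 'M[R]_(n + m)) (U : 'I_N -> 'I_N -> 'M[R]_(m, n + m))
    (Pi : 'M[R]_N) (eps : R) : Prop :=
  [/\ differentiable_sym S,
      forall i, posdefmx (P i),
      col_stochastic Pi,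
      0 < eps
    & forall i : 'I_N,
      [/\ forall tau, 0 <= tau <= Tmax ->
            negsemidefmx (derive_on `[0, Tmax] (S i) tau
                          + S i tau *m (Abar i)^T + Abar i *m S i tau),
          forall theta, Tmin <= theta <= Tmax ->
            negsemidefmx (P i - S i theta + eps%:M)
        & negsemidefmx (block_mx (- S i 0) (Vmx Pi (S i 0) U i)^T
                                 (Vmx Pi (S i 0) U i)
                                 (- \mxdiag_(j < N) P j))]].

(* The first instant t 0 may be any nonnegative time, including 0. *)
Definition range_dwell_time (t : nat -> R) : Prop :=
  0 <= t 0%N /\ forall k, Tmin <= t k.+1 - t k <= Tmax.

Definition augmented (x : R -> 'cV[R]_n) (u : R -> 'cV[R]_m) (s : R) :
  'cV[R]_(n + m) := col_mx (x s) (u s).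

Definition jump_cost (P : 'I_N -> 'M[R]_(n + m))
    (K : 'I_N -> 'I_N -> 'M[R]_(m, n + m)) (i : 'I_N) (chi : 'cV[R]_(n + m))
    (j : 'I_N) : R :=
  (chi^T *m (Jbar K j i)^T *m P j *m Jbar K j i *m chi) 0 0.

(* Trajectories on [0, +oo[ of the closed-loop system. In the last field, j
   is the value sigma(t_k^+): it is an arbitrary minimizer of the cost, and is
   the value of sigma on the whole interval ]t_k, t_{k+1}]. On the initial
   interval [0, t_0] (a single point if t_0 = 0) the mode and the held input
   are constant, as dictated by the flow of the augmented system. *)
Record min_jumping_trajectory (P : 'I_N -> 'M[R]_(n + m))
    (K : 'I_N -> 'I_N -> 'M[R]_(m, n + m)) (t : nat -> R)
    (x : R -> 'cV[R]_n) (u : R -> 'cV[R]_m) (sigma : R -> 'I_N) : Prop :=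
  MinJumpingTrajectory {
  traj_left_continuous : forall s, 0 < s -> x r @[r --> s^'-] --> x s;
  traj_init : forall s, 0 <= s <= t 0%N ->
    sigma s = sigma 0 /\ u s = u 0;
  traj_flow : forall s, 0 <= s -> (forall k, s != t k) ->
    derivable_on `[0, +oo[ x s /\
    derive_on `[0, +oo[ x s = A (sigma s) *m x s + B (sigma s) *m u s;
  traj_jump : forall k, exists j : 'I_N,
    [/\ forall j', jump_cost P K (sigma (t k)) (augmented x u (t k)) j
                   <= jump_cost P K (sigma (t k)) (augmented x u (t k)) j',
        forall s, t k < s <= t k.+1 -> sigma s = j,
        forall s, t k < s <= t k.+1 ->
          u s = gain1 K j (sigma (t k)) *m x (t k)
                + gain2 K j (sigma (t k)) *m u (t k)
      & x s @[s --> (t k)^'+] --> J j (sigma (t k)) *m x (t k)] }.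

Definition closed_loop (P : 'I_N -> 'M[R]_(n + m))
    (K : 'I_N -> 'I_N -> 'M[R]_(m, n + m)) (t : nat -> R) :
    set (R -> 'cV[R]_(n + m)) :=
  [set chi | exists x u sigma,
     min_jumping_trajectory P K t x u sigma /\ chi = augmented x u].

End SwitchedSampledData.

(* Main.v *)
(* A congruence [S(tau) = E^T Q E] by the flow [E = exp(tau A)] satisfies the
   Lyapunov differential equation with equality, while any solution [S] of the
   differential inequality makes [w^T S w] monotone along the flow. This gives
   (a) <-> (b), the strict inequality of (a) being uniform in the dwell time by
   continuity. Statement (c) is the same argument for the inverse matrices: the
   Schur complement of its last inequality bounds the jump form by the inverse of
   [S~(0)], and inversion reverses the order of positive definite matrices;
   conversely [S~ = (E^T (Q + d I) E)^-1] works for small [d > 0].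
   For stability, the Lyapunov function is the minimal jump cost: the minimum over
   the modes is at most the average weighted by a column of [Pi], so (a) makes it
   contract by a fixed factor from one switching instant to the next. *)
Require Import Defs.
From HB Require Import structures.
From mathcomp Require Import all_boot all_order all_algebra.
From mathcomp Require Import all_classical all_reals all_analysis.
From mathcomp Require Import ring lra.
Import Order.TTheory GRing.Theory Num.Theory.
Import numFieldNormedType.Exports.
Local Open Scope classical_set_scope.
Local Open Scope ring_scope.

(** * Matrix calculus and the matrix exponential *)

Lemma cvg_mxP {R : realType} {T : Type} {p q : nat} {F : set_system T}
    {FF : Filter F} {f : T -> 'M[R]_(p, q)} {l : 'M[R]_(p, q)} :
  f x @[x --> F] --> l <-> forall i j, f x i j @[x --> F] --> l i j.
Proof.
split=> [fl i j|fl].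
  exact: (@cvg_comp _ _ _ f (fun M : 'M[R]_(p, q) => M i j) _ _ _ fl
    (@coord_continuous _ _ _ i j l)).
apply/cvgrPdist_le => e e0; near=> x.
rewrite /Num.Def.normr/= mx_normrE (bigmax_le _ (ltW e0))//= => i _.
rewrite !mxE/=.
move: i; near: x; apply: filter_forall => /= i.
exact: ((cvgrPdist_le _ _).1 (fl i.1 i.2)).
Unshelve. all: by end_near. Qed.

Lemma cvg_mulmx {R : realType} {T : Type} {p q r : nat} {F : set_system T}
    {FF : Filter F} {f : T -> 'M[R]_(p, q)} {g : T -> 'M[R]_(q, r)}
    {a : 'M[R]_(p, q)} {b : 'M[R]_(q, r)} :
  f x @[x --> F] --> a -> g x @[x --> F] --> b ->
  f x *m g x @[x --> F] --> a *m b.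
Proof.
move=> /cvg_mxP fa /cvg_mxP gb; apply/cvg_mxP => i k; rewrite mxE.
under eq_fun do rewrite mxE.
by apply: (cvg_big add_continuous) => j _; apply: cvgM; [exact: fa | exact: gb].
Qed.

(** Entrywise, so that the scalar product and chain rules and the mean value theorem apply to each
    entry. *)
Definition is_derive_mx {R : realType} {p q : nat} (M : R -> 'M[R]_(p, q))
    (t : R) (M' : 'M[R]_(p, q)) :=
  forall i j, is_derive t 1 (fun s => M s i j) (M' i j).

Section matrix_derivative.
Context {R : realType} {p q r : nat}.
Implicit Types (t : R) (M : R -> 'M[R]_(p, q)).

Lemma is_derive_mx_cst (C : 'M[R]_(p, q)) t : is_derive_mx (fun=> C) t 0.
Proof. by move=> i j; rewrite mxE; exact: is_derive_cst. Qed.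

Lemma is_derive_mx_tr {M t} {M' : 'M[R]_(p, q)} :
  is_derive_mx M t M' -> is_derive_mx (fun s => (M s)^T) t M'^T.
Proof. by move=> dM i j; rewrite mxE; under eq_fun do rewrite mxE. Qed.

Lemma is_derive_mulmx {M} {L : R -> 'M[R]_(q, r)} {t}
    {M' : 'M[R]_(p, q)} {L' : 'M[R]_(q, r)} :
  is_derive_mx M t M' -> is_derive_mx L t L' ->
  is_derive_mx (fun s => M s *m L s) t (M' *m L t + M t *m L').
Proof.
move=> dM dL i k.
under eq_fun do rewrite mxE.
rewrite -fct_sumE; apply: is_derive_eq.
  apply: is_derive_sum => j.
  exact: (@is_deriveM _ _ (fun s => M s i j) (fun s => L s j k) t 1 _ _
    (dM i j) (dL j k)).
rewrite !mxE -big_split/=; apply: eq_bigr => j _.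
by rewrite addrC; congr (_ + _); exact: mulrC.
Qed.

Lemma is_derive_mx_cvg {M t} {M' : 'M[R]_(p, q)} :
  is_derive_mx M t M' -> M s @[s --> t] --> M t.
Proof.
move=> dM; apply/cvg_mxP => i j; apply: differentiable_continuous.
by apply/derivable1_diffP; have [] := dM i j.
Qed.

Lemma is_derive_mx_comp {M} {g : R -> R} {t} {M' : 'M[R]_(p, q)} {g' : R} :
  is_derive_mx M (g t) M' -> is_derive t 1 g g' ->
  is_derive_mx (fun s => M (g s)) t (g' *: M').
Proof.
move=> dM dg i j; rewrite mxE mulrC.
exact: (@is_derive1_comp _ (fun s => M s i j) g).
Qed.

End matrix_derivative.

Section matrix_exponential.
Context {R : realType} {q : nat}.
Implicit Types (X Y : 'M[R]_q).

(** Its powers dominate all entries of the powers of [X], which allows comparison with a scalar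
    exponential series. *)
Let sum_norm X : R := \sum_i \sum_j `|X i j|.

Let sum_norm_ge0 X : 0 <= sum_norm X.
Proof. by apply: sumr_ge0 => i _; exact: sumr_ge0. Qed.

Let row_norm_le X i : \sum_j `|X i j| <= sum_norm X.
Proof.
rewrite /sum_norm [leRHS](bigD1 i)//= lerDl sumr_ge0// => k _.
exact: sumr_ge0.
Qed.

Let entry_mulmx_le X Y (b : R) i j : 0 <= b -> (forall k l, `|Y k l| <= b) ->
  `|(X *m Y) i j| <= sum_norm X * b.
Proof.
move=> b0 Yb; rewrite mxE (le_trans (ler_norm_sum _ _ _))//.
apply: (@le_trans _ _ (\sum_k `|X i k| * b)).
  by apply: ler_sum => k _; rewrite normrM ler_wpM2l.
by rewrite -mulr_suml ler_wpM2r// row_norm_le.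
Qed.

Let entry_expr_le X n i j : `|(X ^+ n) i j| <= sum_norm X ^+ n.
Proof.
elim: n i j => [|n IHn] i j.
  by rewrite !expr0 mxE; case: eqVneq => _; rewrite ?normr1// normr0 ler01.
by rewrite !exprS; apply: entry_mulmx_le; rewrite ?exprn_ge0.
Qed.

(** Coefficients of the power series in [s] of an entry of [Y *m expmx (s *: X)]. The left factor
    makes the family stable under termwise differentiation, which replaces [Y] by [Y *m X]. *)
Let coef Y X i j : R^nat := fun k => (k`!%:R)^-1 * (Y *m X ^+ k) i j.

Let pseries_diffs_coef Y X i j :
  pseries_diffs (coef Y X i j) = coef (Y *m X) X i j.
Proof.
apply/funext => k; rewrite /pseries_diffs /coef factS natrM invfM !mulrA.
by rewrite divff ?pnatr_eq0// mul1r exprS -mulmxA.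
Qed.

Let is_cvg_coef Y X i j (K : R) : cvgn (pseries (coef Y X i j) K).
Proof.
apply: normed_cvg.
apply: (@series_le_cvg _ _
    (fun k => sum_norm Y * exp_coeff (sum_norm X * `|K|) k)) => [k|k|k|].
- exact: normr_ge0.
- by rewrite mulr_ge0// exp_coeff_ge0// mulr_ge0.
- rewrite /= /coef normrM normrX normrM ger0_norm ?invr_ge0//.
  rewrite exp_coeffE exprMn mulrCA -!mulrA.
  rewrite ler_wpM2l ?invr_ge0// mulrA ler_wpM2r ?exprn_ge0//.
  by apply: entry_mulmx_le => //; rewrite exprn_ge0.
- exact/is_cvg_seriesZ/is_cvg_series_exp_coeff.
Qed.

Lemma scale_exprmx (s : R) X n : (s *: X) ^+ n = s ^+ n *: X ^+ n.
Proof.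
elim: n => [|n IHn]; first by rewrite !expr0 scale1r.
by rewrite !exprS IHn -!mulmxE -scalemxAl -scalemxAr scalerA.
Qed.

Let series_coefE Y X i j s n :
  (Y *m series (fun k => (k`!%:R)^-1 *: (s *: X) ^+ k) n) i j =
  pseries (coef Y X i j) s n.
Proof.
rewrite /pseries /series/= mulmx_sumr summxE; apply: eq_bigr => k _.
by rewrite scale_exprmx -!scalemxAr scalerA mxE /coef mulrAC.
Qed.

(** The exponential is defined through [limn], so it is the sum of its series only once each entry
    is known to converge. *)
Lemma cvg_expmx X : series (fun k => (k`!%:R)^-1 *: X ^+ k) @ \oo --> expmx X.
Proof.
pose l := \matrix_(i, j) limn (pseries (coef 1%:M X i j) 1).
suff Xl : series (fun k => (k`!%:R)^-1 *: X ^+ k) n @[n --> \oo] --> l.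
  by rewrite /expmx (cvg_lim _ Xl).
apply/cvg_mxP => i j; rewrite mxE.
have eq_coef n : series (fun k => (k`!%:R)^-1 *: X ^+ k) n i j =
    pseries (coef 1%:M X i j) 1 n by rewrite -series_coefE mul1mx scale1r.
under eq_fun do rewrite eq_coef.
exact: is_cvg_coef.
Qed.

Let coef_expmx Y X i j s :
  (Y *m expmx (s *: X)) i j = limn (pseries (coef Y X i j) s).
Proof.
apply/esym/cvg_lim => //.
apply: (cvg_trans _ (cvg_mxP.1
  (cvg_mulmx (@cvg_cst _ Y _ \oo _) (cvg_expmx (s *: X))) i j)).
by apply: near_eq_cvg; near=> n; rewrite -series_coefE.
Unshelve. all: by end_near. Qed.

Lemma is_derive_expmx X (t : R) :
  is_derive_mx (fun s => expmx (s *: X)) t (X *m expmx (t *: X)).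
Proof.
move=> i j; rewrite -[X in X *m _]mul1mx coef_expmx -pseries_diffs_coef.
rewrite (_ : (fun s => _) = fun s => limn (pseries (coef 1%:M X i j) s)).
  (* Termwise differentiation inside the radius [|t| + 1], where the series and its first two formal
     derivatives converge. *)
  apply: (@pseries_snd_diffs _ _ (`|t| + 1));
    rewrite ?pseries_diffs_coef; try exact: is_cvg_coef.
  by rewrite [ltRHS]ger0_norm ?addr_ge0// ltrDl.
by apply/funext => s; rewrite -coef_expmx mul1mx.
Qed.

Lemma tr_expmx X : (expmx X)^T = expmx X^T.
Proof.
apply/esym/cvg_lim => //; apply/cvg_mxP => i j; rewrite mxE.
apply: (cvg_trans _ (cvg_mxP.1 (cvg_expmx X) j i)); apply: near_eq_cvg.
near=> n; rewrite /series/= !summxE; apply: eq_bigr => k _.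
rewrite [LHS]mxE [RHS]mxE; congr (_ * _).
suff -> : X^T ^+ k = (X ^+ k)^T by rewrite mxE.
elim: k => [|k IHk]; first by rewrite !expr0 trmx1.
by rewrite exprS exprSr -!mulmxE trmx_mul IHk.
Unshelve. all: by end_near. Qed.

Lemma expmx0 : expmx (0 : 'M[R]_q) = 1%:M.
Proof.
apply/cvg_lim => //; rewrite -cvg_shiftS.
apply: (@cvg_trans _ (1%:M @[n --> \oo])); last exact: cvg_cst.
apply: near_eq_cvg; near=> n => /=.
rewrite /series/= big_nat_recl//= big1 ?addr0 => [|k _].
  by rewrite fact0 invr1 scale1r expr0.
by rewrite exprS mul0r scaler0.
Unshelve. all: by end_near. Qed.

Lemma mulmx_expmxC X : X *m expmx X = expmx X *m X.
Proof.
apply: (cvg_unique _ (cvg_mulmx (@cvg_cst _ X _ \oo _) (cvg_expmx X))) => //.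
apply: (cvg_trans _ (cvg_mulmx (cvg_expmx X) (@cvg_cst _ X _ \oo _))).
apply: near_eq_cvg; near=> n.
rewrite /series/= mulmx_suml mulmx_sumr; apply: eq_bigr => k _.
by rewrite -scalemxAl -scalemxAr; congr (_ *: _); rewrite mulmxE -exprS exprSr.
Unshelve. all: by end_near. Qed.

Lemma is_derive_expmxN X (t : R) :
  is_derive_mx (fun s => expmx (- s *: X)) t (- (X *m expmx (- t *: X))).
Proof.
rewrite -scaleN1r.
exact: (is_derive_mx_comp (is_derive_expmx X (- t)) (is_deriveNid _ _)).
Qed.

Lemma mulmx_expmxZC X (t : R) : X *m expmx (t *: X) = expmx (t *: X) *m X.
Proof.
have [->|t0] := eqVneq t 0; first by rewrite scale0r expmx0 mulmx1 mul1mx.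
apply: (scalerI t0); rewrite scalemxAl scalemxAr; exact: mulmx_expmxC.
Qed.

(** Since [X] commutes with its exponential, the product has zero derivative and keeps its value at
    time 0. *)
Lemma mulmx_expmxN X (t : R) : expmx (t *: X) *m expmx (- t *: X) = 1%:M.
Proof.
pose M s := expmx (s *: X) *m expmx (- s *: X).
have M0 : M 0 = 1%:M by rewrite /M oppr0 scale0r expmx0 mulmx1.
have dM s : is_derive_mx M s 0.
  have := is_derive_mulmx (is_derive_expmx X s) (is_derive_expmxN X s).
  by rewrite mulmxN mulmxA -mulmx_expmxZC subrr.
rewrite -[LHS]/(M t) -M0; apply/matrixP => i j.
apply: (@is_derive_0_is_cst _ (fun s => M s i j)) => s.
by have := dM s i j; rewrite mxE.
Qed.

Lemma mulmx_expmxNl X (t : R) : expmx (- t *: X) *m expmx (t *: X) = 1%:M.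
Proof. by rewrite -[in X in _ *m X](opprK t) mulmx_expmxN. Qed.

End matrix_exponential.

(** * Quadratic forms *)

Lemma cvg_det {R : realType} {T : Type} {q : nat} {F : set_system T}
    {FF : Filter F} {f : T -> 'M[R]_q} {l : 'M[R]_q} :
  f x @[x --> F] --> l -> \det (f x) @[x --> F] --> \det l.
Proof.
move=> /cvg_mxP fl; apply: (cvg_big add_continuous) => s _.
apply: cvgM; first exact: cvg_cst.
by apply: (cvg_big mul_continuous) => i _; exact: fl.
Qed.

(** By the adjugate formula, the determinant being nonzero near its nonzero limit. *)
Lemma cvg_invmx {R : realType} {T : Type} {q : nat} {F : set_system T}
    {FF : Filter F} {f : T -> 'M[R]_q} {l : 'M[R]_q} :
  l \in unitmx -> f x @[x --> F] --> l -> invmx (f x) @[x --> F] --> invmx l.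
Proof.
rewrite unitmxE unitfE => l0 fl.
have det_fl : \det (f x) @[x --> F] --> \det l by exact: cvg_det.
apply: (@cvg_trans _ ((\det (f x))^-1 *: \adj (f x) @[x --> F])).
  apply: near_eq_cvg.
  have := @cvgr_neq0 _ _ _ _ FF _ _ det_fl l0.
  by apply: filterS => x x0; rewrite /invmx unitmxE unitfE x0.
rewrite /invmx unitmxE unitfE l0.
apply/cvg_mxP => i j; rewrite !mxE; under eq_fun do rewrite !mxE.
apply: cvgM; first exact: cvgV.
apply: cvgM; first exact: cvg_cst.
apply: cvg_det; apply/cvg_mxP => k k'; rewrite !mxE.
by under eq_fun do rewrite !mxE; exact: (cvg_mxP.1 fl).
Qed.

Definition quadmx {R : realType} {q : nat} (X : 'M[R]_q) (v : 'cV[R]_q) : R :=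
  (v^T *m X *m v) 0 0.

Section quadratic_form.
Context {R : realType}.

Lemma bilin_tr {p q : nat} (X : 'M[R]_(p, q)) (u : 'cV[R]_p) (v : 'cV[R]_q) :
  (u^T *m X *m v) 0 0 = (v^T *m X^T *m u) 0 0.
Proof.
have -> : v^T *m X^T *m u = (u^T *m X *m v)^T by rewrite !trmx_mul trmxK mulmxA.
by rewrite [RHS]mxE.
Qed.

Context {q : nat}.
Implicit Types (X Y : 'M[R]_q) (u v : 'cV[R]_q).

Lemma quadmxD X Y v : quadmx (X + Y) v = quadmx X v + quadmx Y v.
Proof. by rewrite /quadmx mulmxDr mulmxDl mxE. Qed.

Lemma quadmxN X v : quadmx (- X) v = - quadmx X v.
Proof. by rewrite /quadmx mulmxN mulNmx mxE. Qed.

Lemma quadmxB X Y v : quadmx (X - Y) v = quadmx X v - quadmx Y v.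
Proof. by rewrite quadmxD quadmxN. Qed.

Lemma quadmxZ a X v : quadmx (a *: X) v = a * quadmx X v.
Proof. by rewrite /quadmx -scalemxAr -scalemxAl mxE. Qed.

Lemma quadmx_scalar a v : quadmx a%:M v = a * quadmx 1%:M v.
Proof. by rewrite -quadmxZ scale_scalar_mx mulr1. Qed.

Lemma quadmx_sum (I : finType) (X : I -> 'M[R]_q) v :
  quadmx (\sum_i X i) v = \sum_i quadmx (X i) v.
Proof. by rewrite /quadmx mulmx_sumr mulmx_suml summxE. Qed.

Lemma quadmx_congr {p : nat} (L : 'M[R]_(p, q)) (X : 'M[R]_p) v :
  quadmx (L^T *m X *m L) v = quadmx X (L *m v).
Proof. by rewrite /quadmx trmx_mul !mulmxA. Qed.

Lemma quadmx0r X : quadmx X 0 = 0.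
Proof. by rewrite /quadmx mulmx0 mxE. Qed.

Lemma quadmxNr X v : quadmx X (- v) = quadmx X v.
Proof. by rewrite /quadmx [(- v)^T]linearN/= mulmxN !mulNmx opprK. Qed.

Lemma quadmx1E v : quadmx 1%:M v = \sum_i v i 0 ^+ 2.
Proof.
by rewrite /quadmx mulmx1 mxE; apply: eq_bigr => i _; rewrite mxE expr2.
Qed.

Lemma quadmx1_ge0 v : 0 <= quadmx 1%:M v.
Proof. by rewrite quadmx1E sumr_ge0// => i _; exact: sqr_ge0. Qed.

Lemma quadmx1_gt0 v : v != 0 -> 0 < quadmx 1%:M v.
Proof.
move=> v0; rewrite lt_def quadmx1_ge0 andbT quadmx1E psumr_eq0; last first.
  by move=> i _; exact: sqr_ge0.
apply: contra v0 => /allP v0; apply/eqP/colP => i; rewrite mxE; apply/eqP.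
by rewrite -sqrf_eq0; apply: v0; rewrite mem_index_enum.
Qed.

Lemma posdefmx_ge0 {X} v : posdefmx X -> 0 <= quadmx X v.
Proof.
move=> [_ X0]; have [->|/X0/ltW//] := eqVneq v 0; first by rewrite quadmx0r.
Qed.

Lemma posdefmx_unit {X} : posdefmx X -> X \in unitmx.
Proof.
move=> [_ X0]; rewrite unitmxE unitfE; apply/det0P => -[v v0 vX].
have vT0 : v^T != 0 by rewrite -[0]trmx0 (inj_eq trmx_inj).
by have := X0 _ vT0; rewrite trmxK vX mul0mx mxE ltxx.
Qed.

Lemma quadmx_inv {X} v : posdefmx X ->
  quadmx (invmx X) v = quadmx X (invmx X *m v).
Proof.
move=> pX; rewrite -quadmx_congr trmx_inv (proj1 pX) mulVmx ?mul1mx//.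
exact: posdefmx_unit.
Qed.

Lemma posdefmx_inv {X} : posdefmx X -> posdefmx (invmx X).
Proof.
move=> pX; have uX := posdefmx_unit pX.
split; first by rewrite trmx_inv (proj1 pX).
move=> v v0; rewrite -/(quadmx _ _) quadmx_inv//; apply: (proj2 pX).
apply: contra v0 => /eqP Xv; rewrite -[v]mul1mx -(mulmxV uX) -mulmxA Xv.
by rewrite mulmx0.
Qed.

Lemma quadmxDr X u v : X^T = X ->
  quadmx X (u + v) = quadmx X u + (u^T *m X *m v) 0 0 *+ 2 + quadmx X v.
Proof.
move=> symX; rewrite /quadmx [(u + v)^T]linearD/= mulmxDr !mulmxDl.
have addE (A B : 'M[R]_1) : (A + B) 0 0 = A 0 0 + B 0 0 by rewrite mxE.
have -> : (u^T *m X *m v) 0 0 = (v^T *m X *m u) 0 0 by rewrite bilin_tr symX.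
by rewrite !addE (bilin_tr X u v) symX; lra.
Qed.

(* Expand [0 <= quadmx X (u - invmx X *m v)]. *)
Lemma fenchel_quadmx {X} u v : posdefmx X ->
  (u^T *m v) 0 0 *+ 2 <= quadmx X u + quadmx (invmx X) v.
Proof.
move=> pX; have uX := posdefmx_unit pX.
have := posdefmx_ge0 (u - invmx X *m v) pX.
rewrite quadmxDr ?(proj1 pX)// quadmxNr -quadmx_inv//.
rewrite mulmxN mulmxA mulmxK// [X in _ + X *+ 2 + _]mxE; lra.
Qed.

End quadratic_form.

(** Order reversal under inversion. At [w = invmx X *m (L *m v)] the pairing of [L^T *m w] with [v]
    and the form [quadmx X w] both equal the left-hand side, so [fenchel_quadmx] for [Y]
    concludes. *)
Lemma quadmx_inv_lt {R : realType} {q : nat} {X Y : 'M[R]_q} (L : 'M[R]_q) :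
  posdefmx X -> posdefmx Y ->
  (forall w, w != 0 -> quadmx Y (L^T *m w) < quadmx X w) ->
  forall v, v != 0 -> quadmx (invmx X) (L *m v) < quadmx (invmx Y) v.
Proof.
move=> pX pY ltYX v v0.
(* Here the test vector [w] would vanish, where the strict hypothesis says nothing. *)
have [Lv0|Lv0] := eqVneq (L *m v) 0.
  by rewrite Lv0 quadmx0r; exact: (proj2 (posdefmx_inv pY)).
set w := invmx X *m (L *m v).
have w0 : w != 0.
  apply: contra Lv0 => /eqP w0; rewrite -[L *m v](mulKVmx (posdefmx_unit pX)).
  by rewrite -/w w0 mulmx0.
have wv : ((L^T *m w)^T *m v) 0 0 = quadmx (invmx X) (L *m v).
  by rewrite /quadmx /w !trmx_mul trmxK trmx_inv (proj1 pX) !mulmxA.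
have := fenchel_quadmx (L^T *m w) v pY; rewrite wv.
by have := ltYX w w0; rewrite -quadmx_inv// -/w; lra.
Qed.

(** Apply [fenchel_quadmx] to [v] and a multiple of the [i]-th basis vector; the optimal factor is
    [v i 0] over the diagonal entry of the inverse. *)
Lemma sqr_entry_le {R : realType} {q : nat} {X : 'M[R]_q} (v : 'cV[R]_q) i :
  posdefmx X -> v i 0 ^+ 2 <= invmx X i i * quadmx X v.
Proof.
move=> pX; have [_ /(_ (delta_mx i 0))] := posdefmx_inv pX.
have d0 : (delta_mx i 0 : 'cV[R]_q) != 0.
  apply/eqP => /matrixP/(_ i 0)/eqP; rewrite !mxE !eqxx/=.
  by rewrite oner_eq0.
have dX : (delta_mx i 0)^T *m invmx X *m (delta_mx i 0 : 'cV[R]_q) =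
    (invmx X i i)%:M.
  apply/matrixP => k l; rewrite !ord1 trmx_delta -rowE -colE !mxE eqxx.
  by rewrite mulr1n.
move=> /(_ d0); rewrite dX mxE eqxx mulr1n => a0.
set a := invmx X i i in a0 *.
have := fenchel_quadmx v ((v i 0 / a) *: delta_mx i 0) pX.
rewrite {2}/quadmx [(_ *: delta_mx _ _)^T]linearZ/= -!scalemxAl -!scalemxAr.
rewrite dX -colE !mxE eqxx mulr1n -/a.
rewrite [X in _ <= _ + X](_ : _ = v i 0 ^+ 2 / a); last first.
  by field; rewrite gt_eqF.
rewrite [X in X *+ 2](_ : _ = v i 0 ^+ 2 / a); last by field; rewrite gt_eqF.
by move=> h; rewrite mulrC -ler_pdivrMr//; lra.
Qed.

Lemma quadmx_trinv {R : realType} {q : nat} {X : 'M[R]_q} (v : 'cV[R]_q) :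
  posdefmx X -> quadmx 1%:M v <= \tr (invmx X) * quadmx X v.
Proof.
move=> pX; rewrite quadmx1E /mxtrace mulr_suml; apply: ler_sum => i _.
exact: sqr_entry_le.
Qed.

(* The trace of the inverse is continuous, which replaces compactness of the
   unit sphere. *)
Lemma posdefmx_uniform {R : realType} {q : nat} (M : R -> 'M[R]_q) (a b : R) :
  a <= b -> (forall s, a <= s <= b -> M r @[r --> s] --> M s) ->
  (forall s, a <= s <= b -> posdefmx (M s)) ->
  exists2 c : R, 0 < c &
    forall s, a <= s <= b -> forall v, c * quadmx 1%:M v <= quadmx (M s) v.
Proof.
move=> ab Mc Mp.
have trc : {within `[a, b], continuous (fun s => \tr (invmx (M s)))}.
  apply: continuous_in_subspaceT => s; rewrite inE/= in_itv/= => sab.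
  apply: (cvg_big add_continuous) => i _; apply: (cvg_mxP.1 _ i i).
  apply: cvg_invmx; last exact: Mc.
  by apply: posdefmx_unit; exact: Mp.
have [m _ trm] := EVT_max ab trc.
set C := \tr (invmx (M m)) in trm.
(* Using [|C| + 1] gives a positive bound without determining the sign of [C]. *)
have C0 : 0 < `|C| + 1 by rewrite ltr_wpDl.
exists (`|C| + 1)^-1; first by rewrite invr_gt0.
move=> s sab v; rewrite mulrC ler_pdivrMr// mulrC.
have pM := Mp _ sab.
apply: (le_trans (quadmx_trinv v pM)); apply: ler_wpM2r.
  exact: posdefmx_ge0.
by rewrite (le_trans (trm s _)) ?in_itv// (le_trans (ler_norm _))// lerDl.
Qed.

Section schur_complement.
Context {R : realType} {q N : nat}.
Variables (S : 'M[R]_q) (V P : 'I_N -> 'M[R]_q).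

Local Notation schur_mx :=
  (block_mx (- S) (\mxcol_(j < N) V j)^T (\mxcol_(j < N) V j)
    (- \mxdiag_(j < N) P j)).

Let quadmx_schur (a : 'cV[R]_q) (b : 'I_N -> 'cV[R]_q) :
  quadmx schur_mx (col_mx a (\mxcol_(j < N) b j)) =
  - quadmx S a + \sum_j (((b j)^T *m (V j *m a)) 0 0 *+ 2 - quadmx (P j) (b j)).
Proof.
rewrite /quadmx tr_col_mx mul_row_block mul_row_col !mulmxDl.
have addE (A B : 'M[R]_1) : (A + B) 0 0 = A 0 0 + B 0 0 by rewrite mxE.
rewrite !addE mulmxN !mulNmx mulmxN mulNmx.
have oppE (A : 'M[R]_1) : (- A) 0 0 = - A 0 0 by rewrite mxE.
rewrite !oppE.
rewrite [X in _ + (X + _)](_ : _ =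
    ((\mxcol_(j < N) b j)^T *m \mxcol_(j < N) V j *m a) 0 0); last first.
  by rewrite [LHS]bilin_tr trmxK.
have -> : ((\mxcol_(j < N) b j)^T *m \mxcol_(j < N) V j *m a) 0 0 =
    \sum_j ((b j)^T *m (V j *m a)) 0 0.
  rewrite tr_mxcol mul_mxrow_mxcol mulmx_suml summxE; apply: eq_bigr => j _.
  by rewrite mulmxA.
have -> : ((\mxcol_(j < N) b j)^T *m \mxdiag_(j < N) P j *m
    \mxcol_(j < N) b j) 0 0 = \sum_j quadmx (P j) (b j).
  rewrite -mulmxA mul_mxdiag_mxcol tr_mxcol mul_mxrow_mxcol summxE.
  by apply: eq_bigr => j _; rewrite mulmxA.
rewrite sumrB sumrMnl; lra.
Qed.

Hypothesis pP : forall j, posdefmx (P j).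

(** For fixed [a] the block form is largest at the components [invmx (P j) *m (V j *m a)]. That
    choice gives one direction, [fenchel_quadmx] in each block the other. *)
Lemma negsemidefmx_schur : S^T = S ->
  negsemidefmx schur_mx <->
  forall a, \sum_j quadmx (invmx (P j)) (V j *m a) <= quadmx S a.
Proof.
move=> symS; split=> [[_ le0] a|leS].
  have := le0 (col_mx a (\mxcol_(j < N) (invmx (P j) *m (V j *m a)))).
  rewrite -/(quadmx _ _) quadmx_schur.
  rewrite [X in _ + X](_ : _ = \sum_j quadmx (invmx (P j)) (V j *m a)).
    by lra.
  apply: eq_bigr => j _; rewrite -quadmx_inv//.
  rewrite (_ : ((_ *m _)^T *m _) 0 0 = quadmx (invmx (P j)) (V j *m a)).
    by lra.
  by rewrite /quadmx [in LHS]trmx_mul trmx_inv (proj1 (pP j)).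
split.
  rewrite tr_block_mx trmxK !linearN/= symS tr_mxdiag.
  congr (block_mx _ _ _ (- _)); apply: eq_mxdiag => j.
  by rewrite (proj1 (pP j)).
move=> w; rewrite -[w]vsubmxK -[dsubmx w]submxcolK -/(quadmx _ _) quadmx_schur.
set a := usubmx w; have := leS a.
suff : \sum_j (((submxcol (dsubmx w) j)^T *m (V j *m a)) 0 0 *+ 2 -
    quadmx (P j) (submxcol (dsubmx w) j)) <=
    \sum_j quadmx (invmx (P j)) (V j *m a) by lra.
apply: ler_sum => j _.
have := fenchel_quadmx (submxcol (dsubmx w) j) (V j *m a) (pP j); lra.
Qed.

End schur_complement.

(** * Relative derivatives *)

(** Caratheodory's criterion, with the difference quotient extended by [l] at [t] as slope
    function. *)
Lemma is_derive_diff_quotP {R : realType} (f : R -> R) (t l : R) :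
  is_derive t 1 f l <-> diff_quot f t s @[s --> t^'] --> l.
Proof.
split=> [/is_derive1_caratheodory[g [fg gc gt]]|fl].
  move/continuous_withinNx : gc; rewrite gt; apply: cvg_trans.
  apply: near_eq_cvg; near=> s.
  rewrite /diff_quot fg /GRing.scale/= mulrC mulfK// subr_eq0.
  by near: s; exact: nbhs_dnbhs_neq.
apply/is_derive1_caratheodory.
exists (fun z => if z == t then l else diff_quot f t z); split.
- move=> z; case: eqVneq => [->|zt]; first by rewrite !subrr mulr0.
  by rewrite /diff_quot /GRing.scale/= mulrC mulVKf// subr_eq0.
- apply/continuous_withinNx; rewrite eqxx; apply: cvg_trans fl.
  apply: near_eq_cvg; near=> s; rewrite ifN//.
  by near: s; exact: nbhs_dnbhs_neq.
- by rewrite eqxx.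
Unshelve. all: by end_near. Qed.

Section derivative_on_a_set.
Context {R : realType}.
Implicit Types (D : set R) (t : R).

Lemma derivable_on_cvg {V : normedModType R} {D} {f : R -> V} {t} :
  derivable_on D f t -> f s @[s --> within D (nbhs t)] --> f t.
Proof.
move=> /cvg_ex[l fl].
have tt : s - t @[s --> within D t^'] --> 0.
  rewrite -[0](subrr t); apply: cvgB; last exact: cvg_cst.
  by apply: cvg_within_filter; apply: cvg_within_filter; exact: cvg_id.
have {}fl : f s @[s --> within D t^'] --> f t.
  rewrite -[X in _ --> X]addr0 -(scale0r l).
  apply: (cvg_trans _ (cvgD (@cvg_cst _ (f t) _ _ _) (cvgZ tt fl))).
  apply: near_eq_cvg; rewrite near_withinE; near=> s => _ /=.
  change (f t + (s - t) *: ((s - t)^-1 *: (f s - f t)) = f s).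
  rewrite scalerA divff ?scale1r ?subrKC// subr_eq0.
  by near: s; exact: nbhs_dnbhs_neq.
(* The punctured limit is extended to [t] itself, where [f t] lies in each of its own
   neighbourhoods. *)
move=> U ftU.
have dU : nbhs t (fun s => s != t -> D s -> U (f s)) := fl U ftU.
change (nbhs t (fun s => D s -> U (f s))); apply: filterS dU => s sU Ds.
by have [->|st] := eqVneq s t; [exact: (nbhs_singleton ftU)|exact: sU].
Unshelve. all: by end_near. Qed.

Context {p q : nat}.
Implicit Types (M : R -> 'M[R]_(p, q)).

(** At an interior point the restriction to [D] changes nothing; the relative filter is therefore
    proper, which identifies [lim] with the limit. *)
Lemma derivable_on_is_derive_mx D M t :
  nbhs t D -> derivable_on D M t -> is_derive_mx M t (derive_on D M t).
Proof.
move=> Dt /cvg_ex[l Ml]; rewrite /derive_on.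
have {}Ml : diff_quot M t s @[s --> t^'] --> l.
  move=> U lU.
  have dU : nbhs t (fun s => s != t -> D s -> U (diff_quot M t s)) := Ml U lU.
  change (nbhs t (fun s => s != t -> U (diff_quot M t s))).
  by near=> s => st; apply: (near dU s) => //; exact: (near Dt s).
rewrite (_ : lim _ = l); last first.
  have PF : ProperFilter (within D t^').
    apply: Build_ProperFilter_ex => A dA.
    have dA' : nbhs t (fun s => s != t -> D s -> A s) := dA.
    have : \forall s \near t^', A s.
      change (nbhs t (fun s => s != t -> A s)).
      by near=> s => st; apply: (near dA' s) => //; exact: (near Dt s).
    by move=> nA; case: (@filter_ex _ t^' _ _ nA) => s As; exists s.
  by apply: cvg_lim => //; apply: cvg_within_filter.
move=> i j; apply/is_derive_diff_quotP; have := cvg_mxP.1 Ml i j.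
move=> /(_ _); apply: cvg_trans; apply: near_eq_cvg; near=> s.
by rewrite /diff_quot !mxE.
Unshelve. all: by end_near. Qed.

(** Properness says that [t] is an accumulation point of [D], which makes the relative derivative
    unique. *)
Lemma is_derive_mx_on D M t (M' : 'M[R]_(p, q)) :
  ProperFilter (within D t^') -> is_derive_mx M t M' ->
  derivable_on D M t /\ derive_on D M t = M'.
Proof.
move=> PF dM.
have MM' : diff_quot M t s @[s --> within D t^'] --> M'.
  apply: cvg_within_filter; apply/cvg_mxP => i j.
  move/is_derive_diff_quotP : (dM i j); apply: cvg_trans.
  by apply: near_eq_cvg; near=> s; rewrite /diff_quot !mxE.
by split; [apply/cvg_ex; exists M'|apply: cvg_lim].
Unshelve. all: by end_near. Qed.

Lemma within_itvcc_proper (T t : R) : 0 < T -> 0 <= t <= T ->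
  ProperFilter (within `[0, T] t^').
Proof.
move=> T0 /andP[t0 tT]; apply: Build_ProperFilter_ex => A dA.
have dA' : nbhs t (fun s => s != t -> `[0, T]%classic s -> A s) := dA.
have [tT'|tT'] := ltP t T.
  have : \forall s \near t^'+, A s.
    near=> s; suff : s != t -> `[0, T]%classic s -> A s.
      apply; first by near: s; exact: nbhs_right_neq.
      rewrite /= in_itv/=; apply/andP; split.
        by apply: le_trans t0 _; near: s; exact: nbhs_right_ge.
      by near: s; exact: nbhs_right_le.
    by near: s; exact: (cvg_within _ dA').
  by move=> nA; case: (@filter_ex _ t^'+ _ _ nA) => s As; exists s.
have : \forall s \near t^'-, A s.
  near=> s; suff : s != t -> `[0, T]%classic s -> A s.
    apply; first by near: s; exact: nbhs_left_neq.
    rewrite /= in_itv/=; apply/andP; split.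
      by near: s; apply: nbhs_left_ge; exact: lt_le_trans tT'.
    by apply: le_trans tT; near: s; exact: nbhs_left_le.
  by near: s; exact: (cvg_within _ dA').
by move=> nA; case: (@filter_ex _ t^'- _ _ nA) => s As; exists s.
Unshelve. all: by end_near. Qed.

End derivative_on_a_set.

(** * Quadratic forms along linear flows *)

Lemma is_derive_expmx_flow {R : realType} {q : nat} (X : 'M[R]_q)
    (v : 'cV[R]_q) t :
  is_derive_mx (fun s => expmx (s *: X) *m v) t (X *m (expmx (t *: X) *m v)).
Proof.
move=> i j; apply: is_derive_eq.
  exact: (is_derive_mulmx (is_derive_expmx X t) (is_derive_mx_cst v t) i j).
by rewrite mulmx0 addr0 mulmxA.
Qed.

(** Differentiating [quadmx (S s)] along the flow of [X] yields the form of the Lyapunov operator,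
    so the sign of that operator passes to the increment. The relative derivative is an ordinary one
    inside the interval and gives continuity at its ends. *)
Lemma quadmx_flow_MVT {R : realType} {q : nat} (X : 'M[R]_q) (S : R -> 'M[R]_q)
    {T theta : R} (v : 'cV[R]_q) :
  0 < theta <= T ->
  (forall t, 0 <= t <= T -> derivable_on `[0, T] S t) ->
  exists2 c, 0 <= c <= T &
    quadmx (S theta) (expmx (theta *: X) *m v) - quadmx (S 0) v =
    quadmx (derive_on `[0, T] S c + X^T *m S c + S c *m X)
      (expmx (c *: X) *m v) * theta.
Proof.
move=> /andP[theta0 thetaT] dS.
pose w s := expmx (s *: X) *m v.
have subT s : 0 <= s <= theta -> 0 <= s <= T.
  by move=> /andP[-> st]; rewrite (le_trans st).
pose g s := quadmx (S s) (w s).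
pose g' s := quadmx (derive_on `[0, T] S s + X^T *m S s + S s *m X) (w s).
have dg s : s \in `]0, theta[%R -> is_derive s 1 g (g' s).
  rewrite in_itv/= => /andP[s0 st]; rewrite /g /g' /quadmx.
  have dw := is_derive_expmx_flow X v s.
  have dSs : is_derive_mx S s (derive_on `[0, T] S s).
    apply: derivable_on_is_derive_mx; last by apply: dS; apply: subT; rewrite !ltW.
    have sT : s \in `]0, T[%R by rewrite in_itv/= s0 (lt_le_trans st).
    by apply: filterS (near_in_itvoo sT) => r; exact: subset_itv_oo_cc.
  apply: is_derive_eq.
    exact: (is_derive_mulmx (is_derive_mulmx (is_derive_mx_tr dw) dSs) dw 0 0).
  congr (fun_of_matrix _ 0 0); rewrite -/(w s) trmx_mul.
  rewrite !mulmxDl !mulmxDr !mulmxDl !mulmxA addrAC addrC addrA.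
  by rewrite [X in X + _]addrC.
have cg : {within `[0, theta], continuous g}.
  apply/subspace_continuousP => s; rewrite /= in_itv/= => st.
  apply: (cvg_mxP.1 _ 0 0).
  have wc : w r @[r --> within `[0, theta] (nbhs s)] --> w s.
    apply: cvg_within_filter.
    exact: (is_derive_mx_cvg (is_derive_expmx_flow X v s)).
  apply: (cvg_mulmx _ wc); apply: cvg_mulmx.
    apply/cvg_mxP => i j; rewrite mxE; under eq_fun do rewrite mxE.
    exact: (cvg_mxP.1 wc).
  apply: (cvg_trans _ (derivable_on_cvg (dS s (subT s st)))).
  apply: cvg_app; apply: within_subset => r /=; rewrite !in_itv/=.
  exact: subT.
have [c] := MVT theta0 dg cg.
rewrite subr0 /g {2}/w scale0r expmx0 mul1mx in_itv/= => /andP[c0 ct] gc.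
by exists c => //; apply: subT; rewrite !ltW.
Qed.

(** A uniform lower bound on the Gram matrices of the inverse flow [G] is an upper bound on the
    flow. *)
Lemma quadmx_expmx_bound {R : realType} {q : nat} (X : 'M[R]_q) (a b : R) :
  a <= b -> exists2 C : R, 0 < C & forall s, a <= s <= b ->
    forall v, quadmx 1%:M (expmx (s *: X) *m v) <= C * quadmx 1%:M v.
Proof.
move=> ab; pose G s := expmx (- s *: X).
have dG s : is_derive_mx G s (- (X *m G s)) := is_derive_expmxN X s.
have [c c0 cG] : exists2 c : R, 0 < c & forall s, a <= s <= b ->
    forall v, c * quadmx 1%:M v <= quadmx ((G s)^T *m 1%:M *m G s) v.
  apply: posdefmx_uniform => // s _.
    apply: cvg_mulmx (is_derive_mx_cvg (dG s)); apply: cvg_mulmx.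
      exact: (is_derive_mx_cvg (is_derive_mx_tr (dG s))).
    exact: cvg_cst.
  split; first by rewrite !trmx_mul trmxK trmx1 mulmxA.
  move=> v v0; rewrite -/(quadmx _ _) quadmx_congr quadmx1_gt0//.
  apply: contra v0 => /eqP Gv; rewrite -[v]mul1mx -(mulmx_expmxN X s) -mulmxA.
  by rewrite Gv mulmx0.
exists c^-1; first by rewrite invr_gt0.
move=> s sab v; rewrite mulrC ler_pdivlMr// mulrC.
rewrite (le_trans (cG s sab _))// quadmx_congr mulmxA.
by rewrite (mulmx_expmxNl X) mul1mx.
Qed.

(** Each property holds close to 0 on the right, and finitely many such properties hold there
    jointly. *)
Lemma finite_uniform {R : realType} {N : nat} (P : 'I_N -> R -> Prop) :
  (forall i (e e' : R), 0 < e' <= e -> P i e -> P i e') ->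
  (forall i, exists2 e : R, 0 < e & P i e) ->
  exists2 e : R, 0 < e & forall i, P i e.
Proof.
move=> Pdown Pe.
have nP : \forall e \near (0 : R)^'+, forall i, P i e.
  apply: filter_forall => i; have [e e0 Pie] := Pe i.
  near=> e'; apply: (Pdown i e) => //; apply/andP; split.
    by near: e'; exact: nbhs_right_gt.
  by near: e'; exact: nbhs_right_le.
have {}nP : \forall e \near (0 : R)^'+, 0 < e /\ forall i, P i e.
  by apply: filterI => //; exact: nbhs_right_gt.
by case: (@filter_ex _ 0^'+ _ _ nP) => e [e0 Pie]; exists e.
Unshelve. all: by end_near. Qed.

(** The solution with initial value [Q] of the Lyapunov equation [S' = X^T S + S X]. *)
Definition flow_congr {R : realType} {q : nat} (X Q : 'M[R]_q) (s : R) :=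
  (expmx (s *: X))^T *m Q *m expmx (s *: X).

Section flow_congruence.
Context {R : realType} {q : nat}.
Implicit Types X Q : 'M[R]_q.

Lemma is_derive_flow_congr X Q t : is_derive_mx (flow_congr X Q) t
  (X^T *m flow_congr X Q t + flow_congr X Q t *m X).
Proof.
have dE := is_derive_expmx X t => i j.
apply: is_derive_eq.
  exact: (is_derive_mulmx
    (is_derive_mulmx (is_derive_mx_tr dE) (is_derive_mx_cst Q t)) dE i j).
by rewrite mulmx0 addr0 mulmx_expmxZC trmx_mul /flow_congr !mulmxA.
Qed.

Lemma flow_congr0 X Q : flow_congr X Q 0 = Q.
Proof. by rewrite /flow_congr scale0r expmx0 trmx1 mul1mx mulmx1. Qed.

Lemma tr_flow_congr X Q s : Q^T = Q -> (flow_congr X Q s)^T = flow_congr X Q s.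
Proof. by move=> symQ; rewrite /flow_congr !trmx_mul trmxK symQ mulmxA. Qed.

Lemma derive_on_flow_congr X Q {T t : R} : 0 < T -> 0 <= t <= T ->
  derivable_on `[0, T] (flow_congr X Q) t /\
  derive_on `[0, T] (flow_congr X Q) t =
    X^T *m flow_congr X Q t + flow_congr X Q t *m X.
Proof.
move=> T0 tT; apply: is_derive_mx_on; first exact: within_itvcc_proper.
exact: is_derive_flow_congr.
Qed.

End flow_congruence.

(** * The three matrix conditions *)

Section conditions.
Context {R : realType} {n m N : nat}.
Variables (A : 'I_N -> 'M[R]_n) (B : 'I_N -> 'M[R]_(n, m))
  (J : 'I_N -> 'I_N -> 'M[R]_n) (Tmin Tmax : R).
Hypotheses (Tmin_gt0 : 0 < Tmin) (le_Tmin_Tmax : Tmin <= Tmax).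
Implicit Types (P : 'I_N -> 'M[R]_(n + m)) (Pi : 'M[R]_N)
  (K U : 'I_N -> 'I_N -> 'M[R]_(m, n + m)) (S : 'I_N -> R -> 'M[R]_(n + m)).

Let Tmax_gt0 : 0 < Tmax. Proof. exact: lt_le_trans le_Tmin_Tmax. Qed.

Let dwell_sub {theta} : Tmin <= theta <= Tmax -> 0 < theta <= Tmax.
Proof. by move=> /andP[le_theta ->]; rewrite (lt_le_trans _ le_theta). Qed.

Lemma tr_jump_form Pi P K i :
  (forall j, posdefmx (P j)) -> (jump_form J Pi P K i)^T = jump_form J Pi P K i.
Proof.
move=> pP; rewrite /jump_form linear_sum/=; apply: eq_bigr => j _.
by rewrite linearZ/= !trmx_mul trmxK (proj1 (pP j)) mulmxA.
Qed.

Lemma quadmx_jump_form Pi P K i v : quadmx (jump_form J Pi P K i) v =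
  \sum_j Pi j i * quadmx (P j) (Jbar J K j i *m v).
Proof.
by rewrite quadmx_sum; apply: eq_bigr => j _; rewrite quadmxZ quadmx_congr.
Qed.

Lemma quadmx_jump_form_ge0 Pi P K i v :
  (forall j, posdefmx (P j)) -> col_stochastic Pi ->
  0 <= quadmx (jump_form J Pi P K i) v.
Proof.
move=> pP [Pi0 _]; rewrite quadmx_jump_form; apply: sumr_ge0 => j _.
by rewrite mulr_ge0// posdefmx_ge0.
Qed.

Lemma expmx_tr_congr i theta (X : 'M[R]_(n + m)) :
  expmx (theta *: (Abar A B i)^T) *m X *m expmx (theta *: Abar A B i) =
  flow_congr (Abar A B i) X theta.
Proof. by rewrite /flow_congr tr_expmx linearZ. Qed.

(** The flow of [- Abar] carries [w] back to [v] in time [theta], and the differential inequality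
    puts [S(0)] at [w] below [S(theta)] at [v]. The jump form at [w] is below the former, and the
    latter is below [P i] at [v] by the margin [eps]. *)
Lemma condition_b_a S P K Pi eps :
  condition_b A B J Tmin Tmax S P K Pi eps ->
  condition_a A B J Tmin Tmax P K Pi.
Proof.
move=> [dS pP sPi eps0 bS]; split => // i theta thetaT.
have [flowS lyapS jumpS] := bS i.
rewrite expmx_tr_congr; split.
  by rewrite linearB/= tr_flow_congr ?(proj1 (pP i))//; exact: tr_jump_form.
move=> v v0; rewrite -/(quadmx _ _) quadmxB quadmx_congr.
set w := expmx _ *m v.
have [c cT] := quadmx_flow_MVT (- Abar A B i) (S i) w (dwell_sub thetaT)
  (fun t tT => proj2 (dS i t tT)).
have -> : expmx (theta *: - Abar A B i) *m w = v.
  by rewrite scalerN -scaleNr mulmxA mulmx_expmxNl mul1mx.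
set u := expmx _ *m w; move: (proj2 (flowS c cT) u) (proj2 (lyapS _ thetaT) v)
  (proj2 jumpS w).
rewrite -!/(quadmx _ _) linearN/= mulNmx mulmxN.
rewrite !(quadmxD, quadmxN) (quadmx_scalar eps) => Hu Hv Hw.
have v1 : 0 < eps * quadmx 1%:M v by rewrite mulr_gt0// quadmx1_gt0.
have [theta0 _] := andP (dwell_sub thetaT).
set z := (_ * theta) => Heq.
have : 0 <= z by rewrite /z mulr_ge0 ?(ltW theta0)//; lra.
by lra.
Qed.

Lemma condition_a_gap {P K Pi} : condition_a A B J Tmin Tmax P K Pi ->
  exists2 eps : R, 0 < eps & forall i theta, Tmin <= theta <= Tmax ->
    forall v, eps * quadmx 1%:M v <=
      quadmx (P i - flow_congr (Abar A B i) (jump_form J Pi P K i) theta) v.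
Proof.
move=> [pP sPi aP].
apply: finite_uniform => [i e e' /andP[_ e'e] Pe theta thetaT v|i].
  by rewrite (le_trans _ (Pe _ thetaT v))// ler_wpM2r// quadmx1_ge0.
apply: posdefmx_uniform => // s sT.
  apply: cvgB; first exact: cvg_cst.
  exact: (is_derive_mx_cvg (is_derive_flow_congr _ _ _)).
split.
  by rewrite linearB/= (proj1 (pP i)) tr_flow_congr//; exact: tr_jump_form.
move=> v v0; have := proj2 (aP i s sT) v v0.
by rewrite -!/(quadmx _ _) expmx_tr_congr !quadmxB; lra.
Qed.

Lemma condition_a_b P K Pi : condition_a A B J Tmin Tmax P K Pi ->
  exists S eps, condition_b A B J Tmin Tmax S P K Pi eps.
Proof.
move=> [pP sPi aP].
(* This choice turns the differential and jump inequalities into equalities; [eps] is the gap in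
   (a). *)
pose S i := flow_congr (Abar A B i) (jump_form J Pi P K i).
have symS i s : (S i s)^T = S i s by apply: tr_flow_congr; exact: tr_jump_form.
have [eps eps0 lyapS] := condition_a_gap (And3 pP sPi aP).
exists S, eps; split=> // [i tau tauT|i].
  by split => //; exact: (proj1 (derive_on_flow_congr _ _ Tmax_gt0 tauT)).
split.
- move=> tau tauT.
  rewrite (proj2 (derive_on_flow_congr _ _ Tmax_gt0 tauT)) -addrA addNr.
  by split=> [|v]; rewrite ?trmx0// -/(quadmx _ _) /quadmx mulmx0 mul0mx mxE.
- move=> theta thetaT; split.
    by rewrite !linearD/= linearN/= symS (proj1 (pP i)) tr_scalar_mx.
  move=> v; rewrite -/(quadmx _ _) !quadmxD quadmxN quadmx_scalar.
  by have := lyapS i theta thetaT v; rewrite quadmxB; lra.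
- rewrite /S flow_congr0 subrr.
  by split=> [|v]; rewrite ?trmx0// mulmx0 mul0mx mxE.
Qed.

Lemma JbarM K (S0 : 'M[R]_(n + m)) j i :
  Jbar0 m J j i *m S0 + Jbar1 R n m *m (K j i *m S0) = Jbar J K j i *m S0.
Proof. by rewrite JbarE mulmxDl mulmxA. Qed.

Lemma quadmx_Vmx Pi P K U (S0 : 'M[R]_(n + m)) i a : col_stochastic Pi ->
  (forall j, U j i = K j i *m S0) ->
  \sum_j quadmx (P j) (Num.sqrt (Pi j i) *:
    (Jbar0 m J j i *m S0 + Jbar1 R n m *m U j i) *m a) =
  quadmx (jump_form J Pi P K i) (S0 *m a).
Proof.
move=> [Pi0 _] UK; rewrite quadmx_jump_form; apply: eq_bigr => j _.
rewrite UK JbarM -scalemxAl /quadmx [(_ *: _)^T]linearZ/= -!scalemxAl.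
rewrite -scalemxAr scalerA.
by rewrite -expr2 sqr_sqrtr// mxE !mulmxA.
Qed.

(** The substitution [U = K S0] makes each block of [Vmx] a multiple of [Jbar *m S0]. In the Schur
    complement the square roots then recombine into the weights of the jump form. *)
Lemma negsemidefmx_Vmx {Pi P} K {U} {S0 : 'M[R]_(n + m)} {i} :
  (forall j, posdefmx (P j)) -> S0^T = S0 -> col_stochastic Pi ->
  (forall j, U j i = K j i *m S0) ->
  negsemidefmx (block_mx (- S0) (Vmx J Pi S0 U i)^T (Vmx J Pi S0 U i)
    (- \mxdiag_(j < N) P j)) <->
  forall a, quadmx (jump_form J Pi (fun j => invmx (P j)) K i) (S0 *m a) <=
    quadmx S0 a.
Proof.
move=> pP symS0 sPi UK.
apply: (iff_trans (negsemidefmx_schur _ (fun j => Num.sqrt (Pi j i) *: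
  (Jbar0 m J j i *m S0 + Jbar1 R n m *m U j i)) _ pP symS0)).
by split=> leS a; have := leS a; rewrite (quadmx_Vmx _ _ _ _ _ _ _ sPi UK).
Qed.

(** Positivity of [S i 0] is inherited from [P i]: along the flow of the transposed [Abar] the form
    of [S i] does not increase, and after an admissible dwell time it still exceeds that of
    [P i]. *)
Lemma condition_c_posdef {S P U Pi eps} i :
  condition_c A B J Tmin Tmax S P U Pi eps -> posdefmx (S i 0) /\
  forall theta, Tmin <= theta <= Tmax -> forall w, w != 0 ->
    quadmx (P i) ((expmx (theta *: Abar A B i))^T *m w) < quadmx (S i 0) w.
Proof.
move=> [dS pP sPi eps0 cS]; have [flowS lyapS _] := cS i.
have ltPS theta : Tmin <= theta <= Tmax -> forall w, w != 0 ->
    quadmx (P i) ((expmx (theta *: Abar A B i))^T *m w) < quadmx (S i 0) w.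
  move=> thetaT w w0.
  have [c cT] := quadmx_flow_MVT (Abar A B i)^T (S i) w (dwell_sub thetaT)
    (fun t tT => proj2 (dS i t tT)).
  rewrite -linearZ/= -tr_expmx; set v := (expmx _)^T *m w.
  have v0 : v != 0.
    apply: contra w0 => /eqP v0; rewrite -[w]mul1mx -trmx1.
    by rewrite -(mulmx_expmxN (Abar A B i) theta) trmx_mul -mulmxA -/v v0
      mulmx0.
  set u := expmx _ *m w; move: (proj2 (flowS c cT) u) (proj2 (lyapS _ thetaT) v).
  rewrite -!/(quadmx _ _) trmxK !(quadmxD, quadmxN) (quadmx_scalar eps) => Hu Hv.
  have v1 : 0 < eps * quadmx 1%:M v by rewrite mulr_gt0// quadmx1_gt0.
  have [theta0 _] := andP (dwell_sub thetaT).
  set z := (_ * theta) => Heq.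
  have : z <= 0 by rewrite /z mulr_le0_ge0 ?(ltW theta0)//; lra.
  by lra.
split=> //; split; first by have [] := dS i 0; rewrite // lexx ltW.
have TT : Tmin <= Tmin <= Tmax by rewrite lexx.
by move=> w w0; apply: le_lt_trans (ltPS _ TT w w0); exact: posdefmx_ge0.
Qed.

(** Inverting the strict bound of [condition_c_posdef] puts the inverse of [S i 0], taken at the
    flowed vector [w], below the inverse of [P i]. The Schur complement, tested at
    [invmx (S i 0) *m w], puts the jump form below the inverse of [S i 0]. *)
Lemma condition_c_a S P U Pi eps :
  condition_c A B J Tmin Tmax S P U Pi eps ->
  condition_a A B J Tmin Tmax (fun i => invmx (P i))
    (fun j i => U j i *m invmx (S i 0)) Pi.
Proof.
move=> cS; have [dS pP sPi eps0 cS'] := cS.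
split=> // [i|i theta thetaT]; first exact: posdefmx_inv.
have [pS ltPS] := condition_c_posdef i cS.
rewrite expmx_tr_congr; split.
  rewrite linearB/= trmx_inv (proj1 (pP i)) tr_flow_congr// tr_jump_form// => j.
  exact: posdefmx_inv.
move=> v v0; rewrite -/(quadmx _ _) quadmxB quadmx_congr subr_lt0.
have := quadmx_inv_lt (expmx (theta *: Abar A B i)) pS (pP i)
  (ltPS _ thetaT) _ v0.
apply: le_lt_trans.
have UK j : U j i = U j i *m invmx (S i 0) *m S i 0.
  by rewrite mulmxKV// posdefmx_unit.
have [_ _] := cS' i.
move=> /(negsemidefmx_Vmx (fun j i => U j i *m invmx (S i 0)) pP (proj1 pS)
  sPi UK).
set w := expmx _ *m v => /(_ (invmx (S i 0) *m w)).
by rewrite mulKVmx ?posdefmx_unit// -quadmx_inv.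
Qed.

Lemma condition_a_c P K Pi : condition_a A B J Tmin Tmax P K Pi ->
  exists S P' U eps, condition_c A B J Tmin Tmax S P' U Pi eps.
Proof.
move=> [pP sPi aP].
have [c c0 gapP] := condition_a_gap (And3 pP sPi aP).
(* Half of the gap [c] is reserved for the regularization [d], so that strictness survives it. *)
have [d d0 dE] : exists2 d : R, 0 < d & forall i theta,
    Tmin <= theta <= Tmax -> forall v,
    d * quadmx 1%:M (expmx (theta *: Abar A B i) *m v) <= c / 2 * quadmx 1%:M v.
  apply: finite_uniform => [i e e' /andP[_ e'e] Pe theta thetaT v|i].
    by rewrite (le_trans _ (Pe _ thetaT v))// ler_wpM2r// quadmx1_ge0.
  have [C C0 CE] := quadmx_expmx_bound (Abar A B i) _ _ le_Tmin_Tmax.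
  exists (c / 2 / C) => [|theta thetaT v]; first by rewrite !divr_gt0.
  rewrite -[_ / C * _]mulrA ler_pM2l ?divr_gt0// mulrC ler_pdivrMr// mulrC.
  exact: CE.
(* The jump form is known only to be semidefinite; the shift makes it invertible. *)
pose Q i := jump_form J Pi P K i + d%:M.
have quadQ i v : quadmx (Q i) v =
    quadmx (jump_form J Pi P K i) v + d * quadmx 1%:M v.
  by rewrite quadmxD quadmx_scalar.
have pQ i : posdefmx (Q i).
  split; first by rewrite linearD/= tr_jump_form// tr_scalar_mx.
  move=> v v0; rewrite -/(quadmx _ _) quadQ ltr_wpDl ?quadmx_jump_form_ge0//.
  by rewrite mulr_gt0// quadmx1_gt0.
have ltQP i theta : Tmin <= theta <= Tmax -> forall v, v != 0 ->
    quadmx (Q i) (expmx (theta *: Abar A B i) *m v) < quadmx (P i) v.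
  move=> thetaT v v0; rewrite quadQ.
  have := gapP i _ thetaT v; rewrite quadmxB quadmx_congr.
  have := dE i _ thetaT v.
  have : 0 < c * quadmx 1%:M v by rewrite mulr_gt0// quadmx1_gt0.
  lra.
(* The inverse of [flow_congr (Abar A B i) (Q i)], itself written as a flow congruence, so that the
   differential inequality is again an equality. *)
pose S i := flow_congr (- (Abar A B i)^T) (invmx (Q i)).
have symS i s : (S i s)^T = S i s.
  by apply: tr_flow_congr; exact: (proj1 (posdefmx_inv (pQ i))).
have [eps eps0 lyapS] : exists2 eps : R, 0 < eps & forall i theta,
    Tmin <= theta <= Tmax -> forall v,
    eps * quadmx 1%:M v <= quadmx (S i theta - invmx (P i)) v.
  apply: finite_uniform => [i e e' /andP[_ e'e] Pe theta thetaT v|i].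
    by rewrite (le_trans _ (Pe _ thetaT v))// ler_wpM2r// quadmx1_ge0.
  apply: posdefmx_uniform => // s sT.
    apply: cvgB; last exact: cvg_cst.
    exact: (is_derive_mx_cvg (is_derive_flow_congr _ _ _)).
  split; first by rewrite linearB/= symS (proj1 (posdefmx_inv (pP i))).
  move=> v v0; rewrite -/(quadmx _ _) quadmxB quadmx_congr subr_gt0.
  (* As [L] maps [w] back to [v], the claim is [ltQP] with both sides inverted. *)
  set L := (expmx (s *: Abar A B i))^T; set w := expmx _ *m v.
  have Lw : L *m w = v.
    by rewrite /L /w tr_expmx linearZ/= scalerN -scaleNr mulmxA mulmx_expmxN
      mul1mx.
  rewrite -[in ltLHS]Lw; apply: quadmx_inv_lt => //.
    by rewrite trmxK; exact: ltQP.
  by apply: contra v0 => /eqP w0; rewrite -Lw w0 mulmx0.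
exists S, (fun i => invmx (P i)), (fun j i => K j i *m invmx (Q i)), eps.
split=> // [i tau tauT|i|i].
- by split => //; exact: (proj1 (derive_on_flow_congr _ _ Tmax_gt0 tauT)).
- exact: posdefmx_inv.
split.
- move=> tau tauT.
  rewrite (proj2 (derive_on_flow_congr _ _ Tmax_gt0 tauT)) linearN/= trmxK.
  rewrite mulNmx mulmxN -addrA [X in _ + X]addrC addrACA addNr addNr addr0.
  by split=> [|v]; rewrite ?trmx0// mulmx0 mul0mx mxE.
- move=> theta thetaT; split.
    rewrite !linearD/= linearN/= symS (proj1 (posdefmx_inv (pP i))).
    by rewrite tr_scalar_mx.
  move=> v; rewrite -/(quadmx _ _) !quadmxD quadmxN quadmx_scalar.
  by have := lyapS i theta thetaT v; rewrite quadmxB; lra.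
(* At time 0 the Schur condition only asks that the jump form be below [Q i]. *)
- rewrite /S flow_congr0; apply/(negsemidefmx_Vmx K) => // [j||a].
    exact: posdefmx_inv.
    exact: (proj1 (posdefmx_inv (pQ i))).
  under eq_fun do rewrite invmxK.
  rewrite quadmx_inv//.
  by rewrite quadQ lerDl mulr_ge0 ?(ltW d0)// quadmx1_ge0.
Qed.

End conditions.

(** * Stability under the min-jumping rule *)

Lemma finite_uniform_ub {R : realType} {N : nat} (P : 'I_N -> R -> Prop) :
  (forall i (e e' : R), e <= e' -> P i e -> P i e') ->
  (forall i, exists2 e : R, 0 < e & P i e) ->
  exists2 e : R, 0 < e & forall i, P i e.
Proof.
move=> Pup Pe.
have [i e e' /andP[e'0 e'e]|i|e e0 He] :=
  @finite_uniform R N (fun i e => P i e^-1).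
- by apply: Pup; rewrite lef_pV2// posrE (lt_le_trans e'0).
- have [e e0 Pie] := Pe i; exists e^-1; first by rewrite invr_gt0.
  by rewrite invrK.
- by exists e^-1; first by rewrite invr_gt0.
Qed.

Lemma quadmx_ub {R : realType} {q : nat} (X : 'M[R]_q) :
  exists2 C : R, 0 < C & forall v, quadmx X v <= C * quadmx 1%:M v.
Proof.
exists (\sum_i \sum_j `|X i j| + 1) => [|v].
  by rewrite ltr_wpDl// sumr_ge0// => i _; rewrite sumr_ge0.
have v2 i : v i 0 ^+ 2 <= quadmx 1%:M v.
  rewrite quadmx1E (bigD1 i)//= lerDl sumr_ge0// => j _; exact: sqr_ge0.
apply: (@le_trans _ _ ((\sum_i \sum_j `|X i j|) * quadmx 1%:M v)); last first.
  by rewrite ler_wpM2r ?quadmx1_ge0// lerDl.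
rewrite {1}/quadmx mxE exchange_big/= mulr_suml; apply: ler_sum => j _.
rewrite mxE !mulr_suml; apply: ler_sum => i _; rewrite mxE.
rewrite (le_trans (ler_norm _))// !normrM mulrAC mulrC ler_wpM2l//.
have := v2 i; have := v2 j; rewrite -(real_normK (num_real (v i 0))).
rewrite -(real_normK (num_real (v j 0))).
have := sqr_ge0 (`|v i 0| - `|v j 0|); lra.
Qed.

(** The ambient norm is the maximum norm, whereas the estimates use sums of squares; the reverse
    comparison costs a factor [q]. *)
Lemma sqr_norm_le_quadmx1 {R : realType} {q : nat} (v : 'cV[R]_q) :
  `|v| ^+ 2 <= quadmx 1%:M v.
Proof.
rewrite quadmx1E /Num.Def.normr/= mx_normrE.
apply: (big_ind (fun x : R => x ^+ 2 <= _)) => [|x y|[i j] _]/=.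
- by rewrite expr0n/= sumr_ge0// => i _; exact: sqr_ge0.
- by move=> x2 y2; rewrite /Order.max; case: ifP.
- rewrite real_normK ?num_real// ord1 (bigD1 i)//= lerDl sumr_ge0// => k _.
  exact: sqr_ge0.
Qed.

Lemma quadmx1_le_sqr_norm {R : realType} {q : nat} (v : 'cV[R]_q) :
  quadmx 1%:M v <= q%:R * `|v| ^+ 2.
Proof.
rewrite quadmx1E -[X in X%:R](card_ord q) -sum1_card natr_sum mulr_suml.
apply: ler_sum => i _; rewrite mul1r -real_normK ?num_real// lerXn2r ?nnegrE//.
rewrite [leRHS]/Num.Def.normr/= mx_normrE.
exact: (@le_bigmax _ _ _ 0 (fun ij : 'I_q * 'I_1 => `|v ij.1 ij.2|) (i, 0)).
Qed.

Lemma derive0_eq {R : realType} (f : R -> R) (a b r s : R) :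
  (forall x, a < x < b -> is_derive x 1 f 0) -> a < r -> r < s -> s < b ->
  f r = f s.
Proof.
move=> df ar rs sb.
have dfrs x : r <= x <= s -> is_derive x 1 f 0.
  by move=> /andP[rx xs]; apply: df; rewrite (lt_le_trans ar)// (le_lt_trans xs).
have [||c _ /eqP] := @MVT _ f (fun=> 0) r s rs.
- by move=> x; rewrite in_itv/= => /andP[rx xs]; apply: dfrs; rewrite !ltW.
- by apply: derivable_within_continuous => x; rewrite in_itv/= => /dfrs[].
- by rewrite mul0r subr_eq0 => /eqP.
Qed.

(** Undoing the flow with [E] gives a function of zero derivative, so it equals its limit [z] at [a]
    from the right. That limit replaces [y a] because [y] may jump at [a]; the end [b] is reached by
    left continuity. *)
Lemma flow_solution {R : realType} {q : nat} {X : 'M[R]_q} {y : R -> 'cV[R]_q}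
    {a b : R} {z : 'cV[R]_q} :
  (forall s, a < s < b -> is_derive_mx y s (X *m y s)) ->
  y r @[r --> a^'+] --> z -> y r @[r --> b^'-] --> y b ->
  forall s, a < s <= b -> y s = expmx ((s - a) *: X) *m z.
Proof.
move=> dy yz yb.
pose E s := expmx ((a - s) *: X).
have dE s : is_derive_mx E s (- (X *m E s)).
  rewrite -scaleN1r.
  apply: (is_derive_mx_comp (g := fun s => a - s) (is_derive_expmx X (a - s))).
  by apply: is_derive_eq; rewrite add0r mul1r.
have yE s : a < s < b -> y s = expmx ((s - a) *: X) *m z.
  move=> /andP[sa sb]; suff Eyz : E s *m y s = z.
    by rewrite -Eyz mulmxA /E -(opprB s a) mulmx_expmxN mul1mx.
  have Ey_const r : a < r < s -> E r *m y r = E s *m y s.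
    move=> /andP[ar rs]; apply/matrixP => i j.
    apply: (@derive0_eq _ (fun x => (E x *m y x) i j) a b) => // x axb.
    apply: is_derive_eq; first exact: (is_derive_mulmx (dE x) (dy x axb) i j).
    by rewrite mulmxA -mulmx_expmxZC -mulmxDl addNr mul0mx mxE.
  have Eyz : E r *m y r @[r --> a^'+] --> z.
    have Ea : E r @[r --> a^'+] --> (1%:M : 'M[R]_q).
      have <- : E a = 1%:M by rewrite /E subrr scale0r expmx0.
      apply: cvg_at_right_filter; exact: (is_derive_mx_cvg (dE a)).
    by rewrite -[z]mul1mx; exact: cvg_mulmx.
  apply: (cvg_unique _ _ Eyz) => //.
  apply: (@cvg_trans _ ((E s *m y s) @[_ --> a^'+])); last exact: cvg_cst.
  apply: near_eq_cvg; near=> r; rewrite Ey_const//; apply/andP; split.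
    by near: r; exact: nbhs_right_gt.
  by near: r; exact: nbhs_right_lt.
move=> s /andP[sa]; rewrite le_eqVlt => /orP[/eqP sb|sb]; last first.
  by apply: yE; rewrite sa.
rewrite {}sb in sa *.
apply: (cvg_unique _ yb) => //.
apply: (@cvg_trans _ (expmx ((r - a) *: X) *m z @[r --> b^'-])).
  apply: near_eq_cvg; near=> r; rewrite yE//; apply/andP; split.
    by near: r; exact: nbhs_left_gt.
  by near: r; exact: nbhs_left_lt.
apply: cvg_mulmx; last exact: cvg_cst.
apply: cvg_at_left_filter.
apply: (is_derive_mx_cvg (M := fun r => expmx ((r - a) *: X))
  (M' := 1 *: (X *m expmx ((b - a) *: X)))).
apply: (is_derive_mx_comp (g := fun r => r - a) (is_derive_expmx X (b - a))).
by apply: is_derive_eq; rewrite subr0.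
Unshelve. all: by end_near. Qed.

Lemma dwell_homo {R : realType} {Tmin Tmax : R} {t : nat -> R} :
  0 < Tmin -> range_dwell_time Tmin Tmax t ->
  {homo t : j k / (j < k)%N >-> j < k}.
Proof.
move=> Tmin0 [_ dt]; apply: homo_ltn => [x y z|k]; first exact: lt_trans.
by have /andP[+ _] := dt k; rewrite -subr_gt0; exact: lt_le_trans.
Qed.

(** The instants grow at least linearly, so some instant is at or after [s]; the least one closes
    the interval, and [t k0 < s] keeps its index above [k0]. *)
Lemma dwell_locate {R : realType} {Tmin Tmax : R} {t : nat -> R} k0 s :
  0 < Tmin -> range_dwell_time Tmin Tmax t -> t k0 < s ->
  exists2 k, (k0 <= k)%N & t k < s <= t k.+1.
Proof.
move=> Tmin0 dt k0s; have tmono := dwell_homo Tmin0 dt.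
have [t0 dt'] := dt.
have t_ge k : k%:R * Tmin <= t k.
  elim: k => [|k IHk]; first by rewrite mul0r.
  by have /andP[] := dt' k; rewrite -natr1 mulrDl mul1r; lra.
have ex_k : exists k, s <= t k.
  exists (Num.truncn (s / Tmin)).+1; apply: le_trans (t_ge _).
  by rewrite -ler_pdivrMr// ltW// truncnS_gt.
have [[|k] sk kmin] := ex_minnP ex_k.
  move: k0s; rewrite ltNge => /negP[]; apply: (le_trans sk).
  by have [->//|/lt0n_neq0] := posnP k0; rewrite -lt0n => /tmono/ltW.
have ks : t k < s by rewrite ltNge; apply/negP => /kmin; rewrite ltnn.
exists k; last by rewrite ks.
rewrite leqNgt; apply/negP => kk0.
move: k0s; rewrite ltNge => /negP[]; apply: (le_trans sk).
by move: kk0; rewrite leq_eqVlt => /orP[/eqP->//|/tmono/ltW].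
Qed.

(** * Explicit trajectories between switching instants *)

Section trajectories.
Context {R : realType} {n m N : nat}.
Variables (A : 'I_N -> 'M[R]_n) (B : 'I_N -> 'M[R]_(n, m))
  (J : 'I_N -> 'I_N -> 'M[R]_n) (Tmin Tmax : R).
Hypotheses (Tmin_gt0 : 0 < Tmin) (le_Tmin_Tmax : Tmin <= Tmax).
Variables (P : 'I_N -> 'M[R]_(n + m)) (K : 'I_N -> 'I_N -> 'M[R]_(m, n + m)).
Variables (t : nat -> R) (dwell_t : range_dwell_time Tmin Tmax t).

Let t_homo : {homo t : j k / (j < k)%N >-> j < k}.
Proof. exact: dwell_homo Tmin_gt0 dwell_t. Qed.

Let t_ge0 k : 0 <= t k.
Proof.
have [t0 _] := dwell_t; apply: (le_trans t0).
by case: k => // k; apply/ltW/t_homo.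
Qed.

Let nbhs_ray {s : R} : 0 < s -> nbhs s `[0, +oo[%classic.
Proof.
move=> s0; have : s \in `]0, s + 1[%R by rewrite in_itv/= s0 ltrDl ltr01.
move=> /near_in_itvoo; apply: filterS => r /=.
by rewrite !in_itv/= andbT => /andP[/ltW].
Qed.

(** While mode and input are held, stacking the constant [u0] under [x] gives a solution of the
    autonomous equation of [Abar], to which [flow_solution] applies. *)
Lemma flow_augmented {x : R -> 'cV[R]_n} {u : R -> 'cV[R]_m} {sigma : R -> 'I_N}
    (i : 'I_N) (u0 : 'cV[R]_m) (x0 : 'cV[R]_n) (a b : R) :
  min_jumping_trajectory A B J P K t x u sigma -> 0 <= a -> a < b ->
  (forall s, a < s < b -> forall k, s != t k) ->
  (forall s, a < s <= b -> sigma s = i /\ u s = u0) ->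
  x s @[s --> a^'+] --> x0 ->
  forall s, a < s <= b ->
    augmented x u s = expmx ((s - a) *: Abar A B i) *m col_mx x0 u0.
Proof.
move=> [xl _ xf _] a0 ab nt su xa s sab.
have [_ us] := su s sab; rewrite /augmented us.
have cvg_y (F : set_system R) (l : 'cV[R]_n) : Filter F ->
    x r @[r --> F] --> l -> col_mx (x r) u0 @[r --> F] --> col_mx l u0.
  move=> FF /cvg_mxP xl'; apply/cvg_mxP => j c.
  case: (split_ordP j) => j' ->; rewrite ?col_mxEu ?col_mxEd.
    by under eq_fun do rewrite col_mxEu; exact: xl'.
  by under eq_fun do rewrite col_mxEd; exact: cvg_cst.
apply: (@flow_solution _ _ (Abar A B i) (fun r => col_mx (x r) u0) a b
  (col_mx x0 u0) _ _ _ s sab).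
- move=> r /andP[ar rb]; have r0 := le_lt_trans a0 ar.
  have [dx xE] := xf r (ltW r0) (nt r (introT andP (conj ar rb))).
  have [sr ur] := su r (introT andP (conj ar (ltW rb))).
  have := derivable_on_is_derive_mx _ _ _ (nbhs_ray r0) dx.
  rewrite xE sr ur => dxr.
  rewrite /Abar mul_block_col !mul0mx addr0 => j c.
  case: (split_ordP j) => j' ->; rewrite ?col_mxEu ?col_mxEd.
    by under eq_fun do rewrite col_mxEu; exact: dxr.
  by under eq_fun do rewrite col_mxEd; rewrite mxE; exact: is_derive_cst.
- exact: cvg_y.
- by apply: cvg_y; apply: xl; exact: le_lt_trans ab.
Qed.

Lemma augmented_init {x : R -> 'cV[R]_n} {u : R -> 'cV[R]_m}
    {sigma : R -> 'I_N} :
  min_jumping_trajectory A B J P K t x u sigma ->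
  forall s, 0 <= s <= t 0%N ->
    augmented x u s = expmx (s *: Abar A B (sigma 0)) *m augmented x u 0.
Proof.
move=> traj s /andP[]; rewrite le_eqVlt => /orP[/eqP<- _|s0 st].
  by rewrite scale0r expmx0 mul1mx.
have t00 := lt_le_trans s0 st.
have [xl ti xf _] := traj.
have t0min r k : r < t 0%N -> r != t k.
  move=> rt; rewrite lt_eqF//; apply: (lt_le_trans rt).
  by case: k => // k; apply/ltW/t_homo.
rewrite -[X in expmx (X *: _)](subr0 s).
apply: (@flow_augmented _ _ _ (sigma 0) (u 0) (x 0) 0 (t 0%N) traj (lexx 0)
  t00).
- by move=> r /andP[_ rt] k; exact: t0min.
- by move=> r /andP[r0 rt]; apply: ti; rewrite ltW.
(* Since [0 < t 0], time 0 is not a switching instant, and one-sided derivability there yields the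
   right limit of [x]. *)
- have [dx _] := xf 0 (lexx 0) (fun k => t0min 0 k t00).
  apply: (cvg_trans _ (derivable_on_cvg dx)); apply: cvg_app.
  apply: within_subset => r /=; rewrite in_itv/= andbT; exact: ltW.
- by rewrite s0.
Qed.

Lemma augmented_jump {x : R -> 'cV[R]_n} {u : R -> 'cV[R]_m}
    {sigma : R -> 'I_N} k :
  min_jumping_trajectory A B J P K t x u sigma ->
  let i := sigma (t k) in let j := sigma (t k.+1) in
  let chi := augmented x u (t k) in
  (forall j', quadmx (P j) (Jbar J K j i *m chi) <=
              quadmx (P j') (Jbar J K j' i *m chi)) /\
  forall s, t k < s <= t k.+1 -> augmented x u s =
    expmx ((s - t k) *: Abar A B j) *m (Jbar J K j i *m chi).
Proof.
move=> traj; have [_ _ _ /(_ k)[j0 [jmin sj uj xj]]] := traj.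
have tk : t k < t k.+1 by exact: t_homo.
(* The selected minimizer stays active up to and including [t k.+1], so it can be read off there. *)
move=> i j chi; have j0j : j0 = j by rewrite /j sj// tk lexx.
rewrite {}j0j in jmin sj uj xj; split=> [j'|].
  by have := jmin j'; rewrite /jump_cost /quadmx !trmx_mul !mulmxA.
rewrite /chi /augmented /Jbar mul_block_col mul0mx addr0.
apply: (flow_augmented _ _ _ _ _ traj) => //.
- move=> s /andP[ks sk] l; case: (leqP l k) => [lk|kl].
    rewrite gt_eqF//; apply: le_lt_trans ks.
    by move: lk; rewrite leq_eqVlt => /orP[/eqP->//|/t_homo/ltW].
  rewrite lt_eqF//; apply: (lt_le_trans sk).
  by move: kl; rewrite leq_eqVlt => /orP[/eqP->//|/t_homo/ltW].
- by move=> s sk; split; [exact: sj|exact: uj].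
Qed.

End trajectories.

(** * Contraction of the minimal jump cost *)

Section stability.
Context {R : realType} {n m N : nat}.
Variables (A : 'I_N -> 'M[R]_n) (B : 'I_N -> 'M[R]_(n, m))
  (J : 'I_N -> 'I_N -> 'M[R]_n) (Tmin Tmax : R).
Hypotheses (Tmin_gt0 : 0 < Tmin) (le_Tmin_Tmax : Tmin <= Tmax).
Variables (P : 'I_N -> 'M[R]_(n + m)) (K : 'I_N -> 'I_N -> 'M[R]_(m, n + m)).
Variables (t : nat -> R) (dwell_t : range_dwell_time Tmin Tmax t).

Lemma min_jumping_bound (Pi : 'M[R]_N) : condition_a A B J Tmin Tmax P K Pi ->
  exists G rho : R, [/\ 0 < G, 0 <= rho < 1 &
    forall x u sigma, min_jumping_trajectory A B J P K t x u sigma ->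
    (forall s, 0 <= s <= t 0%N ->
      quadmx 1%:M (augmented x u s) <= G * quadmx 1%:M (augmented x u 0)) /\
    (forall k s, t k < s <= t k.+1 ->
      quadmx 1%:M (augmented x u s) <=
        G * rho ^+ k * quadmx 1%:M (augmented x u 0))].
Proof.
move=> aP; have [pP [Pi0 Pi1] _] := aP.
have [t00 dwell] := dwell_t.
have [c c0 gapP] := condition_a_gap _ _ _ _ _ le_Tmin_Tmax aP.
have [p p0 Pge] : exists2 p : R, 0 < p &
    forall i v, p * quadmx 1%:M v <= quadmx (P i) v.
  apply: finite_uniform => [i e e' /andP[_ e'e] Pe v|i].
    by rewrite (le_trans _ (Pe v))// ler_wpM2r// quadmx1_ge0.
  (* A constant family on a one-point interval. *)
  have [||c' c'0 Pc'] := @posdefmx_uniform R _ (fun=> P i) 0 0 (lexx 0).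
  - by move=> s _; exact: cvg_cst.
  - by [].
  - by exists c' => // v; apply: (Pc' 0); rewrite lexx.
have up (X : R) Y (v : 'cV[R]_(n + m)) e e' : e <= e' ->
    X <= e * quadmx Y v -> 0 <= quadmx Y v -> X <= e' * quadmx Y v.
  by move=> ee' Xe Y0; rewrite (le_trans Xe)// ler_wpM2r.
have [L L0 Ple] : exists2 L : R, 0 < L &
    forall i v, quadmx (P i) v <= L * quadmx 1%:M v.
  apply: finite_uniform_ub => [i e e' ee' Pe v|i]; last exact: quadmx_ub.
  by apply: (up _ _ _ _ _ ee') => //; exact: quadmx1_ge0.
have [C C0 JC] : exists2 C : R, 0 < C & forall j i v,
    quadmx (P j) (Jbar J K j i *m v) <= C * quadmx 1%:M v.
  apply: finite_uniform_ub => [j e e' ee' Pe i v|j].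
    by apply: (up _ _ _ _ _ ee') => //; exact: quadmx1_ge0.
  apply: finite_uniform_ub => [i e e' ee' Pe v|i].
    by apply: (up _ _ _ _ _ ee') => //; exact: quadmx1_ge0.
  have [C C0 JC] := quadmx_ub ((Jbar J K j i)^T *m P j *m Jbar J K j i).
  by exists C => // v; rewrite -quadmx_congr.
have flow_le T : 0 <= T -> exists2 M : R, 0 < M & forall i s, 0 <= s <= T ->
    forall v, quadmx 1%:M (expmx (s *: Abar A B i) *m v) <= M * quadmx 1%:M v.
  move=> T0; apply: finite_uniform_ub => [i e e' ee' Pe s sT v|i].
    by apply: (up _ _ _ _ _ ee'); [exact: Pe|exact: quadmx1_ge0].
  exact: quadmx_expmx_bound.
have Tmax0 : 0 <= Tmax by rewrite (le_trans (ltW Tmin_gt0)).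
have [M M0 flowM] := flow_le _ Tmax0.
(* The first instant is not bounded by [Tmax], so the initial interval gets its own flow bound. *)
have [M' M'0 flowM'] := flow_le _ t00.
have Lc : 0 < L + c by rewrite addr_gt0.
have ML : 0 < M / p * C * M' by rewrite !mulr_gt0// invr_gt0.
(* The summand [M'] covers the initial interval. The product chains the initial flow [M'], the first
   jump cost [C], the passage from cost to norm [1 / p] and the flow [M] over one dwell interval.
   The rate [L / (L + c)] lies in [[0, 1[] without comparing [c] with [L], unlike [1 - c / L]. *)
exists (M' + M / p * C * M'), (L / (L + c)); split.
- by rewrite addr_gt0.
- by rewrite divr_ge0 ?(ltW L0) ?(ltW Lc)//= ltr_pdivrMr// mul1r ltrDl.
move=> x u sigma traj.
have init := augmented_init _ _ _ _ _ Tmin_gt0 _ _ _ dwell_t traj.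
have init_le s : 0 <= s <= t 0%N ->
    quadmx 1%:M (augmented x u s) <= M' * quadmx 1%:M (augmented x u 0).
  by move=> st; rewrite init// flowM'.
split=> [s st|k s sk].
  apply: (up _ _ _ _ _ _ (init_le s st)); last exact: quadmx1_ge0.
  by rewrite lerDl ltW.
pose z k := Jbar J K (sigma (t k.+1)) (sigma (t k)) *m augmented x u (t k).
(* The minimal jump cost at [t k], evaluated through the state [z k] just after the jump. *)
pose W k := quadmx (P (sigma (t k.+1))) (z k).
have jump k' := augmented_jump _ _ _ _ _ Tmin_gt0 _ _ _ dwell_t k' traj.
have W_le k' : W k' <= (L / (L + c)) ^+ k' * W 0%N.
  elim: k' => [|k' IHk]; first by rewrite expr0 mul1r.
  rewrite exprS -mulrA; apply: (@le_trans _ _ (L / (L + c) * W k')); last first.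
    by rewrite ler_pM2l// divr_gt0.
  set i := sigma (t k'.+1).
  (* A minimum is at most the average weighted by column [i] of [Pi]. *)
  have Wavg : W k'.+1 <=
      quadmx (jump_form J Pi P K i) (augmented x u (t k'.+1)).
    have [minW _] := jump k'.+1.
    have Pi_sum : \sum_j Pi j i = 1.
      have /matrixP/(_ 0 i) := Pi1; rewrite !mxE => <-.
      by apply: eq_bigr => j _; rewrite mxE mul1r.
    rewrite quadmx_jump_form -[leLHS]mul1r -Pi_sum mulr_suml.
    by apply: ler_sum => j _; rewrite ler_wpM2l// minW.
  have /andP[dwell1 dwell2] := dwell k'.
  have chiE : augmented x u (t k'.+1) =
      expmx ((t k'.+1 - t k') *: Abar A B i) *m z k'.
    have [_ ->//] := jump k'.
    by rewrite lexx andbT -subr_gt0 (lt_le_trans _ dwell1).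
  have := gapP i (t k'.+1 - t k') (dwell k') (z k').
  rewrite quadmxB quadmx_congr -chiE -/(W k') => gap.
  have WL : W k' <= L * quadmx 1%:M (z k') := Ple _ _.
  have z0 := quadmx1_ge0 (z k').
  rewrite mulrAC ler_pdivlMr//.
  (* Adding [L] times and [c] times this decrease, with [W k'] at most [L] times the squared length
     of [z k'], gives the rate [L / (L + c)]. *)
  have WW : W k'.+1 <= W k' - c * quadmx 1%:M (z k') by lra.
  have LW := ler_wpM2l (ltW L0) WW.
  have cW := ler_wpM2l (ltW c0) WL.
  have cz : 0 <= c * (c * quadmx 1%:M (z k')) by rewrite !mulr_ge0// ltW.
  have cWW := ler_wpM2l (ltW c0) WW.
  lra.
have [_ ->//] := jump k.
have sM : 0 <= s - t k <= Tmax.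
  case/andP: sk => ks sk; rewrite subr_ge0 (ltW ks)/=.
  by case/andP: (dwell k) => _; apply: le_trans; rewrite lerD2r.
apply: (le_trans (flowM _ _ sM _)); rewrite -/(z k).
have zW : quadmx 1%:M (z k) <= W k / p.
  by rewrite ler_pdivlMr// mulrC; exact: Pge.
have W0 : W 0%N <= C * (M' * quadmx 1%:M (augmented x u 0)).
  apply: (le_trans (JC _ _ _)); rewrite ler_pM2l// init_le//.
  by rewrite t00 lexx.
apply: (@le_trans _ _ (M * (((L / (L + c)) ^+ k *
    (C * (M' * quadmx 1%:M (augmented x u 0)))) / p))).
  rewrite ler_pM2l// (le_trans zW)// ler_pM2r ?invr_gt0// (le_trans (W_le k))//.
  by rewrite ler_wpM2l// exprn_ge0// divr_ge0 ?(ltW L0) ?(ltW Lc).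
set r := (L / (L + c)) ^+ k; set q0 := quadmx _ _.
rewrite [leLHS](_ : _ = M / p * C * M' * r * q0); last first.
  by ring.
rewrite ler_wpM2r ?quadmx1_ge0// ler_wpM2r ?lerDr ?(ltW M'0)//.
by rewrite exprn_ge0// divr_ge0 ?(ltW L0) ?(ltW Lc).
Qed.

Lemma min_jumping_stable (Pi : 'M[R]_N) : condition_a A B J Tmin Tmax P K Pi ->
  asymptotically_stable (closed_loop A B J P K t).
Proof.
move=> /min_jumping_bound[G [rho [G0 /andP[rho0 rho1] bound]]].
have locate k s : t k < s -> exists2 k', (k <= k')%N & t k' < s <= t k'.+1.
  exact: (dwell_locate k s Tmin_gt0 dwell_t).
have norm_lt (v : 'cV[R]_(n + m)) (e : R) : 0 < e ->
    quadmx 1%:M v < e ^+ 2 -> `|v| < e.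
  move=> e0 ve; have := le_lt_trans (sqr_norm_le_quadmx1 v) ve.
  by rewrite ltr_pXn2r// nnegrE// ltW.
split.
- move=> e e0; pose g := G * (n + m)%:R.
  have g0 : 0 <= g by rewrite mulr_ge0// ltW.
  have g1 : 0 < g + 1 by rewrite ltr_wpDl.
  (* In maximum norm the squared gain is at most [g], and [g < (g + 1) ^+ 2]. *)
  exists (e / (g + 1)) => [|_ [x [u [sigma [traj ->]]]] chi0 s s0].
    by rewrite divr_gt0.
  have [init jump] := bound _ _ _ traj.
  apply: norm_lt => //.
  apply: (@le_lt_trans _ _ (G * quadmx 1%:M (augmented x u 0))).
    have [st|ts] := leP s (t 0%N); first by apply: init; rewrite s0.
    have [k _ /jump] := locate _ _ ts; move/le_trans; apply.
    rewrite ler_wpM2r ?quadmx1_ge0// ler_piMr ?(ltW G0)//.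
    by rewrite exprn_ile1// ltW.
  apply: (@le_lt_trans _ _ (g * `|augmented x u 0| ^+ 2)).
    by rewrite /g -mulrA ler_pM2l//; exact: quadmx1_le_sqr_norm.
  apply: (@le_lt_trans _ _ (g * (e / (g + 1)) ^+ 2)).
    rewrite ler_wpM2l// lerXn2r ?nnegrE//; last exact: ltW.
    by rewrite divr_ge0// ltW.
  rewrite expr_div_n mulrCA gtr_pMr ?exprn_gt0// ltr_pdivrMr ?exprn_gt0// mul1r.
  nra.
- move=> _ [x [u [sigma [traj ->]]]]; have [init jump] := bound _ _ _ traj.
  apply/cvgrPdist_lt => e e0.
  set q0 := quadmx 1%:M (augmented x u 0) in init jump.
  have q00 : 0 <= q0 := quadmx1_ge0 _.
  (* Every time after [t k0] lies in a dwell interval of index at least [k0], so this one bound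
     serves the whole tail. *)
  have [k0 rhok] : exists k0 : nat, rho ^+ k0 * (G * q0) < e ^+ 2.
    have : (fun k => rho ^+ k * (G * q0)) @ \oo --> (0 : R).
      rewrite -[0](mul0r (G * q0)); apply: cvgM; last exact: cvg_cst.
      by apply: cvg_expr; rewrite ger0_norm.
    move=> /cvgrPdist_lt/(_ (e ^+ 2)); rewrite exprn_gt0// => /(_ isT)[k0 _ Hk].
    exists k0; have := Hk k0 (leqnn k0); rewrite /= sub0r normrN.
    exact: (le_lt_trans (ler_norm _)).
  near=> s; rewrite sub0r normrN; apply: norm_lt => //.
  have ts : t k0 < s by near: s; apply: nbhs_pinfty_gt; exact: num_real.
  have [k k0k /jump] := locate _ _ ts; move/le_lt_trans; apply.
  apply: le_lt_trans rhok; rewrite mulrAC mulrC ler_wpM2r ?mulr_ge0 ?(ltW G0)//.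
  by rewrite ler_wiXn2l// ltW.
Unshelve. all: by end_near. Qed.

End stability.

Theorem theorem12 (R : realType) (n m N : nat)
  (hn : (0 < n)%N) (hm : (0 < m)%N) (hN : (0 < N)%N)
  (A : 'I_N -> 'M[R]_n) (B : 'I_N -> 'M[R]_(n, m))
  (J : 'I_N -> 'I_N -> 'M[R]_n)
  (Tmin Tmax : R) (hTmin : 0 < Tmin) (hTmax : Tmin <= Tmax) :
  [/\ (* (a) <-> (b) *)
      (exists P K Pi, condition_a A B J Tmin Tmax P K Pi) <->
      (exists S P K Pi eps, condition_b A B J Tmin Tmax S P K Pi eps),
      (* (a) <-> (c) *)
      (exists P K Pi, condition_a A B J Tmin Tmax P K Pi) <->
      (exists S P U Pi eps, condition_c A B J Tmin Tmax S P U Pi eps)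
    & forall (S : 'I_N -> R -> 'M[R]_(n + m)) (Pt : 'I_N -> 'M[R]_(n + m))
        (U : 'I_N -> 'I_N -> 'M[R]_(m, n + m)) (Pi : 'M[R]_N) (eps : R),
        condition_c A B J Tmin Tmax S Pt U Pi eps ->
        let P := fun i => invmx (Pt i) in
        let K := fun j i => U j i *m invmx (S i 0) in
        [/\ forall i, S i 0 \in unitmx,
            condition_a A B J Tmin Tmax P K Pi
          & forall t : nat -> R, range_dwell_time Tmin Tmax t ->
              asymptotically_stable (closed_loop A B J P K t)]].

Proof.
split.
- split=> [[P [K [Pi /(condition_a_b _ _ _ _ _ hTmin hTmax)[S [eps bS]]]]]|].
    by exists S, P, K, Pi, eps.
  move=> [S [P [K [Pi [eps /(condition_b_a _ _ _ _ _ hTmin)aP]]]]].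
  by exists P, K, Pi.
- split=> [[P [K [Pi aP]]]|].
    have [S [P' [U [eps cS]]]] := condition_a_c _ _ _ _ _ hTmin hTmax _ _ _ aP.
    by exists S, P', U, Pi, eps.
  move=> [S [P [U [Pi [eps /(condition_c_a _ _ _ _ _ hTmin hTmax)aP]]]]].
  by eexists; eexists; exists Pi; exact: aP.
move=> S Pt U Pi eps cS P K.
have aP := condition_c_a _ _ _ _ _ hTmin hTmax _ _ _ _ _ cS.
split=> // [i|t dwell_t]; last first.
  exact: (min_jumping_stable _ _ _ _ _ hTmin hTmax _ _ _ dwell_t _ aP).
exact: posdefmx_unit (proj1 (condition_c_posdef _ _ _ _ _ hTmin hTmax i cS)).
Qed.
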